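(* Let $(X,d)$ be a geodesic metric space with basepoint $o$, and let $G$ be a countable group of isometries of $X$ containing two independent contracting isometries. Let $\mu$ be a non-elementary probability measure on $G$ with finite first moment. Then there exist $C,\epsilon>0$ such that \[ |l(\mu')-l(\mu)| \le C\,\|\mu'-\mu\|_{0,1} \] for every probability measure $\mu'$ on $G$ with $\|\mu'-\mu\|_{0,1}<\epsilon$.
   Context: For a closed set $A\subseteq X$, $\pi_A$ denotes closest point projection onto $A$. A $K$-quasigeodesic $\gamma$ is a $K$-contracting axis if $\operatorname{diam}(\pi_\gamma(\eta))<K$ for every geodesic $\eta$ not entering the $K$-neighborhood of $\gamma$. An isometry $g$ is contracting if its orbit $\{g^i o\}_{i\in\mathbb Z}$ is a $K$-contracting axis for some $K$; two contracting isometries are independent if their orbits have bounded projections onto each other. A probability measure $\mu$ on $G$ is non-elementary if the semigroup generated by its support contains two independent contracting isometries. For $g\in G$ write $\|g\|=d(o,go)$. For a signed measure $\eta$ on $G$: $\|\eta\|_0=\sum_g|\eta(g)|$, $\|\eta\|_1=\sum_g d(o,go)|\eta(g)|$, $\|\eta\|_{0,1}=\|\eta\|_0+\|\eta\|_1$. $\mu$ has finite first moment if $\|\mu\|_1<\infty$. With $L(\mu)=\sum_g\mu(g)d(o,go)$, the escape rate is $l(\mu)=\lim_{n\to\infty}L(\mu^{*n})/n$, where $\mu^{*n}$ is the $n$-fold convolution. *)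

(* Defs.v *)
From Stdlib Require Import Reals List ZArith ClassicalEpsilon.
From Coquelicot Require Import Coquelicot.
Open Scope R_scope.

Definition is_metric {X : Type} (d : X -> X -> R) : Prop :=
  (forall x y, 0 <= d x y) /\ (forall x y, d x y = 0 <-> x = y) /\
  (forall x y, d x y = d y x) /\ (forall x y z, d x z <= d x y + d y z).

Definition is_geodesic_segment {X : Type} (d : X -> X -> R) (eta : R -> X) (L : R) : Prop :=
  0 <= L /\ forall s t, 0 <= s <= L -> 0 <= t <= L -> d (eta s) (eta t) = Rabs (s - t).

Definition is_geodesic_space {X : Type} (d : X -> X -> R) : Prop :=
  is_metric d /\ forall x y, exists eta : R -> X,
    is_geodesic_segment d eta (d x y) /\ eta 0 = x /\ eta (d x y) = y.

Definition dist_set {X : Type} (d : X -> X -> R) (A : X -> Prop) (x : X) : Rbar :=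
  Glb_Rbar (fun r => exists a, A a /\ r = d x a).

Definition proj {X : Type} (d : X -> X -> R) (A : X -> Prop) (x y : X) : Prop :=
  A y /\ Finite (d x y) = dist_set d A x.

Definition proj_set {X : Type} (d : X -> X -> R) (A S : X -> Prop) (y : X) : Prop :=
  exists x, S x /\ proj d A x y.

Definition diam {X : Type} (d : X -> X -> R) (S : X -> Prop) : Rbar :=
  Lub_Rbar (fun r => exists x y, S x /\ S y /\ r = d x y).

(* sum_{g} f g := sup of finite sums over duplicate-free lists (for f >= 0) *)
Definition nnsum {G : Type} (f : G -> R) : Rbar :=
  Lub_Rbar (fun s => exists l : list G, NoDup l /\ s = fold_right Rplus 0 (map f l)).

Definition is_countable (G : Type) : Prop :=
  exists enc : G -> nat, forall x y, enc x = enc y -> x = y.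

Definition is_group {G : Type} (mul : G -> G -> G) (e : G) (inv : G -> G) : Prop :=
  (forall a b c, mul a (mul b c) = mul (mul a b) c) /\
  (forall a, mul e a = a) /\ (forall a, mul a e = a) /\
  (forall a, mul (inv a) a = e) /\ (forall a, mul a (inv a) = e).

(* G acts faithfully by isometries: G is a group of isometries of X *)
Definition is_isometric_action {G X : Type} (mul : G -> G -> G) (e : G)
  (d : X -> X -> R) (act : G -> X -> X) : Prop :=
  (forall x, act e x = x) /\
  (forall g h x, act (mul g h) x = act g (act h x)) /\
  (forall g x y, d (act g x) (act g y) = d x y) /\
  (forall g h, (forall x, act g x = act h x) -> g = h).

Section GroupDefs.
Context {G X : Type} (mul : G -> G -> G) (e : G) (inv : G -> G)
  (d : X -> X -> R) (act : G -> X -> X) (o : X).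

Fixpoint gpow_nat (g : G) (n : nat) : G :=
  match n with O => e | S n => mul g (gpow_nat g n) end.

Definition gpow (g : G) (z : Z) : G :=
  match z with
  | Z0 => e
  | Zpos p => gpow_nat g (Pos.to_nat p)
  | Zneg p => inv (gpow_nat g (Pos.to_nat p))
  end.

Definition orbit (g : G) : X -> Prop := fun x => exists i : Z, x = act (gpow g i) o.

Definition orbit_quasigeodesic (K : R) (g : G) : Prop :=
  forall i j : Z,
    / K * Rabs (IZR (i - j)) - K <= d (act (gpow g i) o) (act (gpow g j) o) /\
    d (act (gpow g i) o) (act (gpow g j) o) <= K * Rabs (IZR (i - j)) + K.

Definition contracting_set (K : R) (A : X -> Prop) : Prop :=
  forall (eta : R -> X) (L : R), is_geodesic_segment d eta L ->
    (forall t, 0 <= t <= L -> Rbar_le (Finite K) (dist_set d A (eta t))) ->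
    Rbar_lt (diam d (proj_set d A (fun x => exists t, 0 <= t <= L /\ x = eta t)))
            (Finite K).

Definition contracting (g : G) : Prop :=
  exists K, 0 < K /\ orbit_quasigeodesic K g /\ contracting_set K (orbit g).

Definition bounded (S : X -> Prop) : Prop := Rbar_lt (diam d S) p_infty.

Definition independent (g h : G) : Prop :=
  contracting g /\ contracting h /\
  bounded (proj_set d (orbit g) (orbit h)) /\ bounded (proj_set d (orbit h) (orbit g)).

Definition is_prob (mu : G -> R) : Prop :=
  (forall g, 0 <= mu g) /\ nnsum mu = Finite 1.

Definition semigroup_gen (Sg : G -> Prop) (x : G) : Prop :=
  exists l : list G, l <> nil /\ List.Forall Sg l /\ x = fold_right mul e l.

Definition non_elementary (mu : G -> R) : Prop :=
  exists g h, semigroup_gen (fun x => mu x <> 0) g /\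
              semigroup_gen (fun x => mu x <> 0) h /\ independent g h.

Definition gnorm (g : G) : R := d o (act g o).

Definition norm0 (eta : G -> R) : Rbar := nnsum (fun g => Rabs (eta g)).
Definition norm1 (eta : G -> R) : Rbar := nnsum (fun g => gnorm g * Rabs (eta g)).
Definition norm01 (eta : G -> R) : Rbar := Rbar_plus (norm0 eta) (norm1 eta).

Definition finite_first_moment (mu : G -> R) : Prop := Rbar_lt (norm1 mu) p_infty.

(* convolution (mu * nu)(g) = sum_h mu(h) nu(h^-1 g)  (for nonnegative mu, nu) *)
Definition conv (mu nu : G -> R) (g : G) : R :=
  real (nnsum (fun h => mu h * nu (mul (inv h) g))).

Definition dirac (a : G) (g : G) : R := if excluded_middle_informative (g = a) then 1 else 0.

Fixpoint conv_pow (mu : G -> R) (n : nat) : G -> R :=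
  match n with O => dirac e | S n => conv (conv_pow mu n) mu end.

Definition Lmu (mu : G -> R) : R := real (nnsum (fun g => mu g * gnorm g)).

Definition escape_rate (mu : G -> R) : R :=
  real (Lim_seq (fun n => Lmu (conv_pow mu n) / INR n)).

End GroupDefs.

(* Main.v *)
Require Import Defs.
From Stdlib Require Import Reals List ZArith Lia Lra
  FinFun Classical ClassicalEpsilon FunctionalExtensionality.
From Coquelicot Require Import Coquelicot.
Open Scope R_scope.

(** Write [len g] for the displacement of the basepoint and
    [defect u g = len u + len g - len (u g)]. The whole theorem follows from a bound, uniform in
    [n] and [u], on the expectation of [defect u] under [mu^n]: replacing the factors [mu] of
    [mu^n] by [mu'] one at a time, and using that [mu' - mu] has total mass zero, each
    replacement changes the expected length by at most [(1 + C) * norm01 (mu' - mu)].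

    For the bound, let [g], [h] be independent contracting elements of the semigroup and let
    [s_i = g^(p i) h^q g^(p (16 - i))], [i < 16], all of which are charged by one power
    [kappa = mu^N]. If [u^-1 o] does not project far along the translate [g^(p i) <h> o] on the
    left and [v o] does not on the right, then [defect u (s_i v)] is bounded. For each of [u]
    and [v] at most one [i] fails, since far projections to two such translates would force two
    distinct projections to [<g> o]. Splitting off from [kappa] a multiple of the uniform
    measure on the [s_i] gives random "Schottky" steps. If every Schottky step before time [j]
    fails, then at least half of them fail on the same side; failures on the left are
    controlled conditionally on the past and failures on the right conditionally on the
    future, so this has probability decaying exponentially in [j]. The expected
    length travelled before the first success is then finite, and it bounds the defect. *)

(** * Sums of nonnegative families *)

Definition fs {A : Type} (f : A -> R) (l : list A) : R := fold_right Rplus 0 (map f l).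

Lemma fs_cons {A : Type} (f : A -> R) a l : fs f (a :: l) = f a + fs f l.
Proof. reflexivity. Qed.

Lemma fs_le_in {A : Type} (f g : A -> R) l :
  (forall a, In a l -> f a <= g a) -> fs f l <= fs g l.
Proof.
  induction l as [|a l IH]; intros H; [apply Rle_refl|].
  rewrite !fs_cons. apply Rplus_le_compat.
  - apply H; left; reflexivity.
  - apply IH; intros b Hb; apply H; right; exact Hb.
Qed.

Lemma fs_le {A : Type} (f g : A -> R) l : (forall a, f a <= g a) -> fs f l <= fs g l.
Proof. intros H; apply fs_le_in; auto. Qed.

Lemma fs_plus {A : Type} (f g : A -> R) l : fs (fun a => f a + g a) l = fs f l + fs g l.
Proof.
  induction l as [|a l IH]; [unfold fs; simpl; lra|]. rewrite !fs_cons, IH. lra.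
Qed.

Lemma fs_scal {A : Type} c (f : A -> R) l : fs (fun a => c * f a) l = c * fs f l.
Proof.
  induction l as [|a l IH]; [unfold fs; simpl; lra|]. rewrite !fs_cons, IH. lra.
Qed.

Lemma fs_0 {A : Type} (l : list A) : fs (fun _ => 0) l = 0.
Proof. induction l as [|a l IH]; [reflexivity|]. rewrite fs_cons, IH. lra. Qed.

Lemma fs_nonneg {A : Type} (f : A -> R) l : (forall a, 0 <= f a) -> 0 <= fs f l.
Proof. intros H. rewrite <- (fs_0 l). apply fs_le; exact H. Qed.

Lemma fs_app {A : Type} (f : A -> R) l l' : fs f (l ++ l') = fs f l + fs f l'.
Proof.
  induction l as [|a l IH]; [unfold fs at 2; simpl; lra|].
  simpl. rewrite !fs_cons, IH. lra.
Qed.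

Lemma fs_map {A B : Type} (h : A -> B) (f : B -> R) l :
  fs f (map h l) = fs (fun a => f (h a)) l.
Proof. unfold fs. rewrite map_map. reflexivity. Qed.

Lemma fs_incl {A : Type} (f : A -> R) l l' :
  (forall a, 0 <= f a) -> NoDup l -> incl l l' -> fs f l <= fs f l'.
Proof.
  intros Hf Hl. revert l'. induction Hl as [|a l Ha Hl IH]; intros l' Hi.
  - apply fs_nonneg; exact Hf.
  - destruct (in_split a l' (Hi a (or_introl eq_refl))) as [l1 [l2 ->]].
    rewrite fs_app, !fs_cons.
    assert (H : fs f l <= fs f (l1 ++ l2)).
    { apply IH. intros b Hb. specialize (Hi b (or_intror Hb)).
      apply in_app_iff in Hi. apply in_app_iff.
      destruct Hi as [Hi|[Hi|Hi]]; auto. subst; contradiction. }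
    rewrite fs_app in H. lra.
Qed.

(** For a nonnegative family this is summability. For a signed one it only bounds the finite sums
    from above, which is why additivity and the exchange of sums below ask for nonnegative terms. *)
Definition sm {A : Type} (f : A -> R) : Prop := exists B, forall l, NoDup l -> fs f l <= B.
(* [Sm f] is the junk value 0 unless [sm f]. *)
Definition Sm {A : Type} (f : A -> R) : R := real (nnsum f).

Lemma nnsum_sm {A : Type} (f : A -> R) : sm f -> nnsum f = Finite (Sm f).
Proof.
  intros [B HB]. unfold Sm, nnsum.
  match goal with |- Lub_Rbar ?E = _ => destruct (Lub_Rbar_correct E) as [H1 H2] end.
  assert (H : Rbar_le
    (Lub_Rbar (fun s => exists l, NoDup l /\ s = fold_right Rplus 0 (map f l))) B).
  { apply H2. intros x [l [Hl ->]]. apply HB; exact Hl. }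
  (* The empty list has sum 0, so the supremum is not minus infinity. *)
  assert (H0 := H1 0 (ex_intro _ nil (conj (NoDup_nil A) eq_refl))).
  destruct (Lub_Rbar _); simpl in *; try contradiction. reflexivity.
Qed.

Lemma Sm_ub {A : Type} (f : A -> R) l : sm f -> NoDup l -> fs f l <= Sm f.
Proof.
  intros Hs Hl. assert (E := nnsum_sm f Hs). unfold nnsum in E.
  match type of E with Lub_Rbar ?E = _ => destruct (Lub_Rbar_correct E) as [H1 _] end.
  rewrite E in H1. exact (H1 (fs f l) (ex_intro _ l (conj Hl eq_refl))).
Qed.

Lemma Sm_lub {A : Type} (f : A -> R) B : (forall l, NoDup l -> fs f l <= B) -> Sm f <= B.
Proof.
  intros HB. assert (E := nnsum_sm f (ex_intro _ B HB)). unfold nnsum in E.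
  match type of E with Lub_Rbar ?E = _ => destruct (Lub_Rbar_correct E) as [_ H2] end.
  rewrite E in H2. apply (H2 (Finite B)). intros x [l [Hl ->]]. apply HB; exact Hl.
Qed.

Lemma sm_of_nnsum {A : Type} (f : A -> R) : Rbar_lt (nnsum f) p_infty -> sm f.
Proof.
  unfold nnsum. intros H.
  match type of H with Rbar_lt (Lub_Rbar ?E) _ => destruct (Lub_Rbar_correct E) as [H1 _] end.
  assert (H0 := H1 0 (ex_intro _ nil (conj (NoDup_nil A) eq_refl))).
  destruct (Lub_Rbar _) as [r| |]; simpl in *; try contradiction.
  exists r. intros l Hl. exact (H1 (fs f l) (ex_intro _ l (conj Hl eq_refl))).
Qed.

Lemma Sm_approx {A : Type} (f : A -> R) eps :
  0 < eps -> exists l, NoDup l /\ Sm f - eps <= fs f l.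
Proof.
  intros He. apply NNPP; intros Hn.
  assert (H : Sm f <= Sm f - eps); [|lra].
  apply Sm_lub. intros l Hl. apply Rnot_lt_le. intros Hlt.
  apply Hn. exists l. split; [exact Hl|lra].
Qed.

Lemma Sm_nonneg {A : Type} (f : A -> R) : sm f -> 0 <= Sm f.
Proof. intros H. apply (Sm_ub f nil H). constructor. Qed.

Lemma Sm_ge1 {A : Type} (f : A -> R) a : sm f -> f a <= Sm f.
Proof.
  intros H. assert (H1 := Sm_ub f (a :: nil) H).
  unfold fs in H1; simpl in H1. rewrite Rplus_0_r in H1. apply H1.
  constructor; [intros []|constructor].
Qed.

Lemma sm_le {A : Type} (f g : A -> R) : (forall a, f a <= g a) -> sm g -> sm f.
Proof.
  intros H [B HB]. exists B. intros l Hl.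
  apply Rle_trans with (fs g l); [apply fs_le; exact H|apply HB; exact Hl].
Qed.

Lemma Sm_le {A : Type} (f g : A -> R) : (forall a, f a <= g a) -> sm g -> Sm f <= Sm g.
Proof.
  intros H Hg. apply Sm_lub. intros l Hl.
  apply Rle_trans with (fs g l); [apply fs_le; exact H|apply Sm_ub; assumption].
Qed.

Lemma sm_plus {A : Type} (f g : A -> R) : sm f -> sm g -> sm (fun a => f a + g a).
Proof.
  intros Hf Hg. exists (Sm f + Sm g). intros l Hl. rewrite fs_plus.
  apply Rplus_le_compat; apply Sm_ub; assumption.
Qed.

Lemma NoDup_merge {A : Type} (l l' : list A) :
  exists m, NoDup m /\ incl l m /\ incl l' m.
Proof.
  exists (nodup (fun x y => excluded_middle_informative (x = y)) (l ++ l')).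
  split; [apply NoDup_nodup|]. split; intros a Ha; apply nodup_In, in_app_iff; auto.
Qed.

Lemma Sm_plus {A : Type} (f g : A -> R) : (forall a, 0 <= f a) -> (forall a, 0 <= g a) ->
  sm f -> sm g -> Sm (fun a => f a + g a) = Sm f + Sm g.
Proof.
  intros Hf0 Hg0 Hf Hg. apply Rle_antisym.
  - apply Sm_lub. intros l Hl. rewrite fs_plus.
    apply Rplus_le_compat; apply Sm_ub; assumption.
  - apply le_epsilon. intros eps He.
    destruct (Sm_approx f (eps / 2)) as [l [Hl Hfl]]; [lra|].
    destruct (Sm_approx g (eps / 2)) as [l' [Hl' Hgl]]; [lra|].
    destruct (NoDup_merge l l') as [m [Hm [Hi Hi']]].
    assert (H := Sm_ub _ m (sm_plus f g Hf Hg) Hm). rewrite fs_plus in H.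
    assert (H1 := fs_incl f l m Hf0 Hl Hi). assert (H2 := fs_incl g l' m Hg0 Hl' Hi'). lra.
Qed.

Lemma sm_scal {A : Type} c (f : A -> R) : 0 <= c -> sm f -> sm (fun a => c * f a).
Proof.
  intros Hc [B HB]. exists (c * B). intros l Hl. rewrite fs_scal.
  apply Rmult_le_compat_l; auto.
Qed.

Lemma Sm_0 {A : Type} : Sm (fun _ : A => 0) = 0.
Proof.
  assert (H : sm (fun _ : A => 0)) by (exists 0; intros; rewrite fs_0; lra).
  apply Rle_antisym; [|apply Sm_nonneg; exact H].
  apply Sm_lub; intros; rewrite fs_0; lra.
Qed.

Lemma Sm_scal {A : Type} c (f : A -> R) : 0 <= c -> sm f -> Sm (fun a => c * f a) = c * Sm f.
Proof.
  intros [Hc|<-] Hf.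
  - apply Rle_antisym.
    + apply Sm_lub. intros l Hl. rewrite fs_scal.
      apply Rmult_le_compat_l; [lra|apply Sm_ub; assumption].
    + apply Rmult_le_reg_l with (/ c); [apply Rinv_0_lt_compat; exact Hc|].
      rewrite <- Rmult_assoc, Rinv_l, Rmult_1_l by lra.
      apply Sm_lub. intros l Hl. apply Rmult_le_reg_l with c; [exact Hc|].
      rewrite <- Rmult_assoc, Rinv_r, Rmult_1_l, <- fs_scal by lra.
      apply Sm_ub; [apply sm_scal; [lra|exact Hf]|exact Hl].
  - rewrite Rmult_0_l.
    replace (fun a => 0 * f a) with (fun _ : A => 0); [apply Sm_0|].
    apply functional_extensionality; intros a; ring.
Qed.

Lemma sm_fs {A B : Type} (f : A -> B -> R) l :
  (forall b, In b l -> sm (fun a => f a b)) -> sm (fun a => fs (f a) l).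
Proof.
  induction l as [|b l IH]; intros H.
  - exists 0. intros l _. unfold fs at 2; simpl. rewrite fs_0; lra.
  - apply (sm_plus (fun a => f a b) (fun a => fs (f a) l)).
    + apply H; left; reflexivity.
    + apply IH; intros c Hc; apply H; right; exact Hc.
Qed.

Lemma Sm_fs {A B : Type} (f : A -> B -> R) l : (forall a b, 0 <= f a b) ->
  (forall b, In b l -> sm (fun a => f a b)) ->
  Sm (fun a => fs (f a) l) = fs (fun b => Sm (fun a => f a b)) l.
Proof.
  intros H0. induction l as [|b l IH]; intros H.
  - apply Sm_0.
  - rewrite fs_cons, <- IH by (intros c Hc; apply H; right; exact Hc).
    apply (Sm_plus (fun a => f a b) (fun a => fs (f a) l)).
    + intros a; apply H0.
    + intros a; apply fs_nonneg; intros; apply H0.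
    + apply H; left; reflexivity.
    + apply sm_fs; intros c Hc; apply H; right; exact Hc.
Qed.

(** Over a finite list of [b] the two sums commute by [Sm_fs], and a partial sum is at most the full
    inner sum; the supremum over lists gives the inequality. Using it in both directions yields
    [tonelli]. *)
Lemma tonelli_le {A B : Type} (f : A -> B -> R) : (forall a b, 0 <= f a b) ->
  (forall a, sm (f a)) -> sm (fun a => Sm (f a)) ->
  (forall b, sm (fun a => f a b)) /\ sm (fun b => Sm (fun a => f a b)) /\
  Sm (fun b => Sm (fun a => f a b)) <= Sm (fun a => Sm (f a)).
Proof.
  intros H0 Hi Ho.
  assert (H1 : forall b, sm (fun a => f a b)).
  { intros b. apply sm_le with (2 := Ho). intros a. apply Sm_ge1, Hi. }
  assert (H2 : forall l, NoDup l ->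
    fs (fun b => Sm (fun a => f a b)) l <= Sm (fun a => Sm (f a))).
  { intros l Hl. rewrite <- Sm_fs by auto.
    apply Sm_le; [|exact Ho]. intros a; apply Sm_ub; auto. }
  split; [exact H1|]. split; [eexists; exact H2|apply Sm_lub; exact H2].
Qed.

Lemma tonelli {A B : Type} (f : A -> B -> R) : (forall a b, 0 <= f a b) ->
  (forall a, sm (f a)) -> sm (fun a => Sm (f a)) ->
  Sm (fun b => Sm (fun a => f a b)) = Sm (fun a => Sm (f a)).
Proof.
  intros H0 Hi Ho. destruct (tonelli_le f H0 Hi Ho) as [H1 [H2 H3]].
  apply Rle_antisym; [exact H3|].
  apply (tonelli_le (fun b a => f a b)); auto.
Qed.

Lemma sm_reindex {A B : Type} (h : A -> B) (f : B -> R) :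
  (forall a a', h a = h a' -> a = a') -> sm f -> sm (fun a => f (h a)).
Proof.
  intros Hh [C HC]. exists C. intros l Hl. rewrite <- fs_map. apply HC.
  apply FinFun.Injective_map_NoDup; assumption.
Qed.

Lemma Sm_reindex {A B : Type} (h : A -> B) (k : B -> A) (f : B -> R) :
  (forall a, k (h a) = a) -> (forall b, h (k b) = b) -> sm f ->
  Sm (fun a => f (h a)) = Sm f.
Proof.
  intros Hkh Hhk Hf.
  assert (Hh : forall a a', h a = h a' -> a = a').
  { intros a a' E. rewrite <- (Hkh a), E. apply Hkh. }
  assert (Hk : forall b b', k b = k b' -> b = b').
  { intros b b' E. rewrite <- (Hhk b), E. apply Hhk. }
  apply Rle_antisym; apply Sm_lub; intros l Hl.
  - rewrite <- fs_map. apply Sm_ub; [exact Hf|].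
    apply FinFun.Injective_map_NoDup; assumption.
  - replace (fs f l) with (fs (fun a => f (h a)) (map k l)).
    + apply Sm_ub; [apply sm_reindex; assumption|].
      apply FinFun.Injective_map_NoDup; assumption.
    + rewrite fs_map. f_equal. apply functional_extensionality; intros b.
      rewrite Hhk; reflexivity.
Qed.

(** * Expectations of functions of linear growth *)

Section LengthFunction.
Context {G : Type} (mul : G -> G -> G) (e : G) (inv : G -> G) (len : G -> R).
Hypothesis Hgrp : is_group mul e inv.
Hypothesis len_ge0 : forall g, 0 <= len g.
Hypothesis len_mul : forall g h, len (mul g h) <= len g + len h.

(** Probability measures with finite first moment: a class closed under convolution, for which all
    expectations of [lin_growth] functions are finite. *)
Definition prob1 (mu : G -> R) : Prop :=
  (forall g, 0 <= mu g) /\ sm mu /\ Sm mu = 1 /\ sm (fun g => mu g * len g).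

(** The integrands are nonnegative because [Sm] is a supremum of finite sums. Linear growth is
    stable under left translation and under averaging over the right factor ([lin_growth_Ex]), so
    iterated expectations stay meaningful. *)
Definition lin_growth (F : G -> R) : Prop :=
  exists c, 0 <= c /\ forall g, 0 <= F g <= c * (1 + len g).

Definition Ex (mu F : G -> R) : R := Sm (fun g => mu g * F g).

Lemma mulA a b c : mul a (mul b c) = mul (mul a b) c.
Proof. apply Hgrp. Qed.
Lemma mule_l a : mul e a = a.
Proof. apply Hgrp. Qed.
Lemma mule_r a : mul a e = a.
Proof. apply Hgrp. Qed.
Lemma mulKV a b : mul (inv a) (mul a b) = b.
Proof. destruct Hgrp as [H1 [H2 [_ [H3 _]]]]. rewrite H1, H3. apply H2. Qed.
Lemma mulVK a b : mul a (mul (inv a) b) = b.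
Proof. destruct Hgrp as [H1 [H2 [_ [_ H3]]]]. rewrite H1, H3. apply H2. Qed.

Lemma lin_growth_len : lin_growth len.
Proof. exists 1. split; [lra|]. intros g. generalize (len_ge0 g). lra. Qed.

Lemma lin_growth_const c : 0 <= c -> lin_growth (fun _ => c).
Proof. intros Hc. exists c. split; [lra|]. intros g. generalize (len_ge0 g). nra. Qed.

Lemma lin_growth_plus F F' :
  lin_growth F -> lin_growth F' -> lin_growth (fun g => F g + F' g).
Proof.
  intros [c [Hc H]] [c' [Hc' H']]. exists (c + c'). split; [lra|].
  intros g. generalize (H g), (H' g), (len_ge0 g). nra.
Qed.

Lemma lin_growth_scal c F : 0 <= c -> lin_growth F -> lin_growth (fun g => c * F g).
Proof.
  intros Hc [c' [Hc' H]]. exists (c * c'). split; [nra|].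
  intros g. generalize (H g), (len_ge0 g). intros.
  split; [nra|]. rewrite Rmult_assoc. apply Rmult_le_compat_l; lra.
Qed.

Lemma lin_growth_le F F' :
  (forall g, 0 <= F g <= F' g) -> lin_growth F' -> lin_growth F.
Proof.
  intros H [c [Hc H']]. exists c. split; [exact Hc|].
  intros g. generalize (H g), (H' g). lra.
Qed.

Lemma lin_growth_shift F a : lin_growth F -> lin_growth (fun b => F (mul a b)).
Proof.
  intros [c [Hc H]]. exists (c * (1 + len a)). split.
  - generalize (len_ge0 a); nra.
  - intros b. split; [apply H|]. apply Rle_trans with (1 := proj2 (H _)).
    rewrite Rmult_assoc. apply Rmult_le_compat_l; [exact Hc|].
    generalize (len_mul a b), (len_ge0 a), (len_ge0 b). nra.
Qed.

Lemma prob1_sm mu F : prob1 mu -> lin_growth F -> sm (fun g => mu g * F g).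
Proof.
  intros [H0 [H1 [_ H2]]] [c [Hc H]].
  apply sm_le with (fun g => c * (mu g + mu g * len g)).
  - intros g. generalize (H0 g), (H g), (len_ge0 g). intros.
    apply Rle_trans with (mu g * (c * (1 + len g))); [apply Rmult_le_compat_l; lra|].
    apply Req_le; ring.
  - apply sm_scal; [exact Hc|]. apply sm_plus; assumption.
Qed.

Lemma Ex_le mu F F' : prob1 mu -> lin_growth F' -> (forall g, F g <= F' g) ->
  Ex mu F <= Ex mu F'.
Proof.
  intros Hm Hg H. apply Sm_le; [|apply prob1_sm; assumption].
  intros g. apply Rmult_le_compat_l; [apply Hm|apply H].
Qed.

Lemma Ex_plus mu F F' : prob1 mu -> lin_growth F -> lin_growth F' ->
  Ex mu (fun g => F g + F' g) = Ex mu F + Ex mu F'.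
Proof.
  intros Hm HF HF'. unfold Ex.
  rewrite <- Sm_plus; try (apply prob1_sm; assumption).
  - f_equal. apply functional_extensionality; intros g; ring.
  - intros g. apply Rmult_le_pos; [apply Hm|]. destruct HF as [c [_ H]]. apply H.
  - intros g. apply Rmult_le_pos; [apply Hm|]. destruct HF' as [c [_ H]]. apply H.
Qed.

Lemma Ex_scal mu c F : prob1 mu -> 0 <= c -> lin_growth F ->
  Ex mu (fun g => c * F g) = c * Ex mu F.
Proof.
  intros Hm Hc HF. unfold Ex.
  rewrite <- Sm_scal; try (apply prob1_sm; assumption); [|exact Hc].
  f_equal. apply functional_extensionality; intros g; ring.
Qed.

Lemma Ex_const mu c : prob1 mu -> 0 <= c -> Ex mu (fun _ => c) = c.
Proof.
  intros Hm Hc. unfold Ex. replace (fun g => mu g * c) with (fun g => c * mu g).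
  - destruct Hm as [_ [H1 [H2 _]]]. rewrite Sm_scal by assumption. rewrite H2. ring.
  - apply functional_extensionality; intros g; ring.
Qed.

Lemma Ex_nonneg mu F : prob1 mu -> lin_growth F -> 0 <= Ex mu F.
Proof. intros Hm HF. apply Sm_nonneg, prob1_sm; assumption. Qed.

Lemma Ex_ge1 mu F a : prob1 mu -> lin_growth F -> mu a * F a <= Ex mu F.
Proof.
  intros Hm HF. apply (Sm_ge1 (fun g => mu g * F g)). apply prob1_sm; assumption.
Qed.

Lemma lin_growth_Ex nu F : prob1 nu -> lin_growth F ->
  lin_growth (fun a => Ex nu (fun b => F (mul a b))).
Proof.
  intros Hn HF. destruct (HF) as [c [Hc H]].
  assert (HL := Ex_nonneg nu len Hn lin_growth_len).
  exists (c * (1 + Ex nu len)). split; [nra|]. intros a. split.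
  { apply Ex_nonneg; [exact Hn|]. apply lin_growth_shift; exact HF. }
  assert (Ha := len_ge0 a).
  apply Rle_trans with (Ex nu (fun b => c * ((1 + len a) + len b))).
  - apply Ex_le; [exact Hn| |].
    + apply lin_growth_scal; [exact Hc|]. apply lin_growth_plus; [|apply lin_growth_len].
      apply lin_growth_const; lra.
    + intros b. apply Rle_trans with (1 := proj2 (H _)).
      apply Rmult_le_compat_l; [exact Hc|]. generalize (len_mul a b); lra.
  - assert (Hg := lin_growth_const (1 + len a) ltac:(lra)). assert (Hl := lin_growth_len).
    rewrite Ex_scal by (try apply lin_growth_plus; assumption).
    rewrite Ex_plus by assumption. rewrite Ex_const by (try assumption; lra).
    rewrite Rmult_assoc. apply Rmult_le_compat_l; [exact Hc|]. nra.
Qed.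

(** Tonelli for the mass of the pair of steps [h], [h^-1 g], weighted by [F g]; the substitution
    [g = h b] in the inner sum gives the right side. Summability is carried along for [conv_prob1],
    which takes [F = 1] and [F = len]. *)
Lemma conv_Ex_aux mu nu F : prob1 mu -> prob1 nu -> lin_growth F ->
  sm (fun g => conv mul inv mu nu g * F g) /\
  Ex (conv mul inv mu nu) F = Ex mu (fun a => Ex nu (fun b => F (mul a b))).
Proof.
  intros Hm Hn HF.
  assert (HF0 : forall g, 0 <= F g) by (destruct HF as [c [_ H]]; intros; apply H).
  assert (Hm0 := proj1 Hm). assert (Hn0 := proj1 Hn).
  set (f := fun h g => mu h * nu (mul (inv h) g) * F g).
  assert (f0 : forall h g, 0 <= f h g).
  { intros; unfold f; repeat apply Rmult_le_pos; auto. }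
  assert (Hs : forall h, sm (fun b => nu b * F (mul h b))).
  { intros h. apply prob1_sm; [exact Hn|]. apply lin_growth_shift; exact HF. }
  assert (Er : forall h,
    f h = fun g => (fun b => mu h * (nu b * F (mul h b))) (mul (inv h) g)).
  { intros h. apply functional_extensionality; intros g. unfold f.
    rewrite mulVK. ring. }
  assert (f1 : forall h, sm (f h)).
  { intros h. rewrite Er.
    apply sm_reindex with (f := fun b => mu h * (nu b * F (mul h b))).
    - intros a b E. rewrite <- (mulVK h a), E. apply mulVK.
    - apply sm_scal; auto. }
  assert (f2 : forall h, Sm (f h) = mu h * Ex nu (fun b => F (mul h b))).
  { intros h. rewrite Er.
    etransitivity; [apply (Sm_reindex (mul (inv h)) (mul h)
      (fun b => mu h * (nu b * F (mul h b))))|apply Sm_scal; auto].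
    - intros a; apply mulVK.
    - intros b; apply mulKV.
    - apply sm_scal; auto. }
  assert (f3 : sm (fun h => Sm (f h))).
  { apply sm_le with (fun h => mu h * Ex nu (fun b => F (mul h b))).
    - intros h; rewrite f2; apply Rle_refl.
    - apply prob1_sm; [exact Hm|]. apply lin_growth_Ex; assumption. }
  assert (Hc : forall g, sm (fun h => mu h * nu (mul (inv h) g))).
  { intros g. apply sm_le with (fun h => Sm nu * mu h).
    - intros h. rewrite Rmult_comm. apply Rmult_le_compat_r; [auto|].
      apply Sm_ge1, Hn.
    - apply sm_scal; [apply Sm_nonneg|]; apply Hm || apply Hn. }
  assert (Ec : (fun g => conv mul inv mu nu g * F g) = fun g => Sm (fun h => f h g)).
  { apply functional_extensionality; intros g. unfold conv.
    change (real (nnsum (fun h => mu h * nu (mul (inv h) g))))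
      with (Sm (fun h => mu h * nu (mul (inv h) g))).
    rewrite Rmult_comm, <- Sm_scal by auto. f_equal.
    apply functional_extensionality; intros h. unfold f; ring. }
  unfold Ex at 1. rewrite Ec. split.
  - apply (tonelli_le f f0 f1 f3).
  - rewrite tonelli by assumption. unfold Ex at 1. f_equal.
    apply functional_extensionality; exact f2.
Qed.

Lemma conv_prob1 mu nu : prob1 mu -> prob1 nu -> prob1 (conv mul inv mu nu).
Proof.
  intros Hm Hn.
  assert (H1 := lin_growth_const 1 ltac:(lra)).
  destruct (conv_Ex_aux mu nu (fun _ => 1) Hm Hn H1) as [S1 E1].
  destruct (conv_Ex_aux mu nu len Hm Hn lin_growth_len) as [S2 _].
  assert (E : (fun g => conv mul inv mu nu g * 1) = conv mul inv mu nu).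
  { apply functional_extensionality; intros g; ring. }
  rewrite E in S1. repeat split; auto.
  - intros g. unfold conv. apply Sm_nonneg.
    apply sm_le with (fun h => Sm nu * mu h).
    + intros h. rewrite Rmult_comm. apply Rmult_le_compat_r; [apply Hm|].
      apply Sm_ge1, Hn.
    + apply sm_scal; [apply Sm_nonneg|]; apply Hm || apply Hn.
  - unfold Ex at 1 in E1. rewrite E in E1. rewrite E1.
    rewrite (Ex_const nu 1) by (assumption || lra). apply Ex_const; [exact Hm|lra].
Qed.

Lemma conv_Ex mu nu F : prob1 mu -> prob1 nu -> lin_growth F ->
  Ex (conv mul inv mu nu) F = Ex mu (fun a => Ex nu (fun b => F (mul a b))).
Proof. intros; apply conv_Ex_aux; assumption. Qed.

Lemma fs_dirac (F : G -> R) a l : NoDup l ->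
  fs (fun g => dirac a g * F g) l = if excluded_middle_informative (In a l) then F a else 0.
Proof.
  induction 1 as [|b l Hb Hl IH].
  - destruct (excluded_middle_informative (In a nil)) as [[]|]. reflexivity.
  - rewrite fs_cons, IH. unfold dirac.
    destruct (excluded_middle_informative (b = a)) as [->|Hne];
    destruct (excluded_middle_informative (In a l));
    destruct (excluded_middle_informative (In a (_ :: l))) as [Hi|Hi]; simpl in Hi;
    try contradiction; try tauto; try ring.
Qed.

Lemma dirac_sum (F : G -> R) a : 0 <= F a ->
  sm (fun g => dirac a g * F g) /\ Sm (fun g => dirac a g * F g) = F a.
Proof.
  intros HF.
  assert (H : forall l, NoDup l -> fs (fun g => dirac a g * F g) l <= F a).
  { intros l Hl. rewrite fs_dirac by exact Hl.
    destruct (excluded_middle_informative (In a l)); lra. }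
  split; [exists (F a); exact H|]. apply Rle_antisym; [apply Sm_lub; exact H|].
  apply Rle_trans with (dirac a a * F a).
  - unfold dirac. destruct (excluded_middle_informative (a = a)); [lra|contradiction].
  - apply (Sm_ge1 (fun g => dirac a g * F g)). exists (F a); exact H.
Qed.

Lemma dirac_ge0 (a g : G) : 0 <= dirac a g.
Proof. unfold dirac. destruct (excluded_middle_informative (g = a)); lra. Qed.

Lemma dirac_prob1 a : prob1 (dirac a).
Proof.
  destruct (dirac_sum (fun _ => 1) a ltac:(lra)) as [H1 H2].
  replace (fun g => dirac a g * 1) with (dirac a) in H1, H2
    by (apply functional_extensionality; intros; ring).
  repeat split; auto using dirac_ge0. apply dirac_sum. apply len_ge0.
Qed.

Lemma Ex_dirac F a : 0 <= F a -> Ex (dirac a) F = F a.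
Proof. apply dirac_sum. Qed.

(** * Convolution powers and the words they charge *)

Notation pow := (conv_pow mul e inv).

Lemma pow_prob1 mu n : prob1 mu -> prob1 (pow mu n).
Proof.
  intros Hm. induction n as [|n IH]; [apply dirac_prob1|]. apply conv_prob1; assumption.
Qed.

Lemma pow_add mu m n F : prob1 mu -> lin_growth F ->
  Ex (pow mu (m + n)) F = Ex (pow mu m) (fun a => Ex (pow mu n) (fun b => F (mul a b))).
Proof.
  intros Hm. revert F. induction n as [|n IH]; intros F HF.
  - rewrite Nat.add_0_r. f_equal. apply functional_extensionality; intros a. simpl.
    destruct HF as [c [_ H]].
    rewrite Ex_dirac by apply H. rewrite mule_r. reflexivity.
  - rewrite Nat.add_succ_r. simpl.
    assert (Hn := pow_prob1 mu n Hm).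
    rewrite conv_Ex by (try apply pow_prob1; assumption).
    rewrite IH by (apply lin_growth_Ex; assumption).
    f_equal. apply functional_extensionality; intros a.
    rewrite conv_Ex by (try apply lin_growth_shift; assumption).
    f_equal. apply functional_extensionality; intros b.
    f_equal. apply functional_extensionality; intros c. rewrite mulA. reflexivity.
Qed.

Lemma pow_1 mu F : prob1 mu -> lin_growth F -> Ex (pow mu 1) F = Ex mu F.
Proof.
  intros Hm HF. simpl. rewrite conv_Ex by (try apply dirac_prob1; assumption).
  rewrite Ex_dirac by (apply Ex_nonneg; try apply lin_growth_shift; assumption).
  f_equal. apply functional_extensionality; intros b. rewrite mule_l. reflexivity.
Qed.

Lemma pow_S mu n F : prob1 mu -> lin_growth F ->
  Ex (pow mu (S n)) F = Ex mu (fun a => Ex (pow mu n) (fun b => F (mul a b))).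
Proof.
  intros Hm HF. change (S n) with (1 + n)%nat. rewrite pow_add by assumption.
  apply pow_1; [exact Hm|]. apply lin_growth_Ex; [apply pow_prob1|]; assumption.
Qed.

Lemma pow_mul mu N n F : prob1 mu -> lin_growth F ->
  Ex (pow mu (n * N)) F = Ex (pow (pow mu N) n) F.
Proof.
  intros Hm. assert (HN := pow_prob1 mu N Hm).
  revert F; induction n as [|n IH]; intros F HF; [reflexivity|].
  rewrite pow_S by assumption.
  simpl Nat.mul. rewrite pow_add by assumption. f_equal.
  apply functional_extensionality; intros a. apply IH. apply lin_growth_shift; exact HF.
Qed.

Lemma lin_growth_dirac a : lin_growth (dirac a).
Proof.
  apply lin_growth_le with (fun _ => 1); [|apply lin_growth_const; lra].
  intros g; split; [apply dirac_ge0|]. unfold dirac.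
  destruct (excluded_middle_informative _); lra.
Qed.

(** [dirac a] also serves as the indicator function of [a], so that point masses of convolution
    powers become expectations. *)
Lemma Ex_indicator mu a : prob1 mu -> Ex mu (dirac a) = mu a.
Proof.
  intros Hm. rewrite <- (Ex_dirac mu a) by apply Hm.
  unfold Ex. f_equal. apply functional_extensionality; intros g. apply Rmult_comm.
Qed.

(** Keeps the single pair [x], [y] in the double expectation of the indicator of [x y]. *)
Lemma pow_pos_mul mu m n x y : prob1 mu ->
  0 < pow mu m x -> 0 < pow mu n y -> 0 < pow mu (m + n) (mul x y).
Proof.
  intros Hm Hx Hy. set (F := dirac (mul x y)).
  assert (HF : lin_growth F) by apply lin_growth_dirac.
  assert (Hp := fun n => pow_prob1 mu n Hm).
  rewrite <- Ex_indicator by apply Hp. rewrite pow_add by assumption.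
  apply Rlt_le_trans with (2 := Ex_ge1 _ _ x (Hp m) (lin_growth_Ex _ F (Hp n) HF)).
  apply Rmult_lt_0_compat; [exact Hx|].
  apply Rlt_le_trans with (2 := Ex_ge1 _ _ y (Hp n) (lin_growth_shift F x HF)).
  apply Rmult_lt_0_compat; [exact Hy|].
  unfold F, dirac. destruct (excluded_middle_informative _); [lra|contradiction].
Qed.

Lemma pow_pos_word mu l : prob1 mu -> List.Forall (fun x => mu x <> 0) l ->
  0 < pow mu (length l) (fold_right mul e l).
Proof.
  intros Hm. induction 1 as [|x l Hx Hl IH].
  - simpl. unfold dirac. destruct (excluded_middle_informative _); [lra|contradiction].
  - simpl fold_right. change (length (x :: l)) with (1 + length l)%nat.
    apply pow_pos_mul; [exact Hm| |exact IH].
    rewrite <- Ex_indicator by (apply pow_prob1; exact Hm).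
    rewrite pow_1 by (try apply lin_growth_dirac; exact Hm).
    rewrite Ex_indicator by exact Hm. generalize (proj1 Hm x). lra.
Qed.

Lemma pow_pos_gpow_nat mu g k n : prob1 mu -> 0 < pow mu k g ->
  0 < pow mu (n * k) (gpow_nat mul e g n).
Proof.
  intros Hm Hg. induction n as [|n IH].
  - simpl. unfold dirac. destruct (excluded_middle_informative _); [lra|contradiction].
  - simpl Nat.mul. simpl gpow_nat. apply pow_pos_mul; assumption.
Qed.

(** * Bounded expected defect from a Schottky set *)

(** For the displacement of [o] this is twice the Gromov product of [u^-1 o] and [g o] based at
    [o]. *)
Definition defect (u g : G) : R := len u + len g - len (mul u g).

Hypothesis len_inv : forall g, len (inv g) = len g.
Hypothesis len_e : len e = 0.

Lemma len_mul_ge u g : len u - len g <= len (mul u g).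
Proof.
  assert (H := len_mul (mul u g) (inv g)). rewrite len_inv in H.
  destruct Hgrp as [H1 [_ [H2 [_ H3]]]]. rewrite <- H1, H3, H2 in H. lra.
Qed.

Lemma defect_bounds u g : 0 <= defect u g <= 2 * len g.
Proof. unfold defect. generalize (len_mul u g), (len_mul_ge u g). lra. Qed.

Lemma lin_growth_defect u : lin_growth (defect u).
Proof.
  apply lin_growth_le with (fun g => 2 * len g); [apply defect_bounds|].
  apply lin_growth_scal; [lra|apply lin_growth_len].
Qed.

(** The two values are inverse to each other: a product of two penalties is at least 1 as soon as
    one side is bad, while the average over 16 indices, at most one of them bad, is below 1/2. *)
Definition penalty (P : Prop) : R := if excluded_middle_informative P then 4 else 1 / 4.

Lemma penalty_bounds P : 1 / 4 <= penalty P <= 4.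
Proof. unfold penalty. destruct (excluded_middle_informative P); lra. Qed.

Lemma fs_penalty (P : nat -> Prop) l : NoDup l ->
  (forall i j, In i l -> In j l -> P i -> P j -> i = j) ->
  fs (fun i => penalty (P i)) l <= INR (length l) / 4 + 15 / 4.
Proof.
  induction 1 as [|a l Ha Hl IH]; intros Hu.
  - unfold fs; simpl; lra.
  - rewrite fs_cons. change (length (a :: l)) with (S (length l)). rewrite S_INR.
    unfold penalty at 1. destruct (excluded_middle_informative (P a)) as [Pa|Pa].
    + assert (E : fs (fun i => penalty (P i)) l <= fs (fun _ => 1 / 4) l).
      { apply fs_le_in. intros i Hi. unfold penalty.
        destruct (excluded_middle_informative (P i)) as [Pi|]; [|lra].
        exfalso. apply Ha. rewrite (Hu a i); simpl; auto. }
      assert (E' : fs (fun _ => 1 / 4) l = INR (length l) / 4).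
      { clear. induction l as [|b l IH]; [unfold fs; simpl; lra|].
        rewrite fs_cons, IH. change (length (b :: l)) with (S (length l)).
        rewrite S_INR. lra. }
      lra.
    + assert (IH' := IH (fun i j Hi Hj => Hu i j (or_intror Hi) (or_intror Hj))). lra.
Qed.

(** * A random walk with Schottky steps, in abstract form *)

Section Schottky.
Context (kappa : G -> R) (s : nat -> G) (badA badB : G -> nat -> Prop) (beta C : R).
Hypothesis Hk : prob1 kappa.
Hypothesis C_ge0 : 0 <= C.
Hypothesis beta_gt0 : 0 < beta.
Hypothesis Hs : forall i, (i < 16)%nat -> 16 * beta <= kappa (s i).
Hypothesis badA_unique : forall u i j,
  (i < 16)%nat -> (j < 16)%nat -> badA u i -> badA u j -> i = j.
Hypothesis badB_unique : forall v i j,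
  (i < 16)%nat -> (j < 16)%nat -> badB v i -> badB v j -> i = j.
Hypothesis good_defect : forall u v i, (i < 16)%nat -> ~ badA u i -> ~ badB v i ->
  defect u (mul (s i) v) <= C.

(** Counted with multiplicity, since the [s i] may coincide: [marked] can reach 16 at one element,
    which is why [Hs] asks for the mass [16 * beta]. *)
Definition marked (g : G) : R := fs (fun i => dirac (s i) g) (seq 0 16).
Definition unmarked (g : G) : R := kappa g - beta * marked g.

Lemma marked_ge0 g : 0 <= marked g.
Proof. apply fs_nonneg; intros; apply dirac_ge0. Qed.

Lemma unmarked_ge0 g : 0 <= unmarked g.
Proof.
  unfold unmarked.
  destruct (classic (exists i, (i < 16)%nat /\ s i = g)) as [[i [Hi <-]]|Hn].
  - assert (H := Hs i Hi).
    assert (marked (s i) <= 16); [|nra].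
    unfold marked. apply Rle_trans with (fs (fun _ : nat => 1) (seq 0 16)).
    + apply fs_le. intros j. unfold dirac.
      destruct (excluded_middle_informative _); lra.
    + unfold fs; simpl; lra.
  - replace (marked g) with 0; [generalize (proj1 Hk g); lra|].
    apply Rle_antisym; [apply marked_ge0|].
    rewrite <- (fs_0 (seq 0 16)). apply fs_le_in. intros i Hi.
    unfold dirac. destruct (excluded_middle_informative _) as [E|]; [|lra].
    exfalso. apply Hn. exists i. apply in_seq in Hi. split; [lia|auto].
Qed.

Lemma unmarked_le g : unmarked g <= kappa g.
Proof. unfold unmarked. generalize (marked_ge0 g). nra. Qed.

Lemma unmarked_sm F : lin_growth F -> sm (fun g => unmarked g * F g).
Proof.
  intros HF. apply sm_le with (2 := prob1_sm kappa F Hk HF). intros g.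
  destruct HF as [c [_ H]]. apply Rmult_le_compat_r; [apply H|apply unmarked_le].
Qed.

Lemma Ex_split F : lin_growth F ->
  Ex kappa F = Ex unmarked F + beta * fs (fun i => F (s i)) (seq 0 16).
Proof.
  intros HF. destruct (HF) as [c [_ H]].
  assert (Em : (fun g => marked g * F g)
    = fun g => fs (fun i => dirac (s i) g * F g) (seq 0 16)).
  { apply functional_extensionality; intros g. unfold marked.
    rewrite Rmult_comm, <- fs_scal. f_equal.
    apply functional_extensionality; intros i; ring. }
  assert (Sd : forall i, In i (seq 0 16) -> sm (fun g => dirac (s i) g * F g)).
  { intros i _. apply dirac_sum, H. }
  assert (Sk : sm (fun g => marked g * F g)) by (rewrite Em; apply sm_fs; exact Sd).
  transitivity (Ex unmarked F + beta * Sm (fun g => marked g * F g)).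
  - unfold Ex. rewrite <- Sm_scal by (assumption || lra). rewrite <- Sm_plus.
    + f_equal. apply functional_extensionality; intros g. unfold unmarked. ring.
    + intros g. apply Rmult_le_pos; [apply unmarked_ge0|apply H].
    + intros g. apply Rmult_le_pos; [lra|].
      apply Rmult_le_pos; [apply marked_ge0|apply H].
    + apply unmarked_sm; exact HF.
    + apply sm_scal; [lra|exact Sk].
  - rewrite Em, Sm_fs.
    + do 2 f_equal. f_equal. apply functional_extensionality; intros i. apply Ex_dirac, H.
    + intros g i. apply Rmult_le_pos; [apply dirac_ge0|apply H].
    + exact Sd.
Qed.

(* A letter [inl a] is an unmarked step of the walk, [inr i] a step drawn from the
   Schottky set. *)
Definition val (t : G + nat) : G := match t with inl a => a | inr i => s i end.
Definition wval (l : list (G + nat)) : G := fold_right mul e (map val l).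

(** Only Schottky letters are weighted. Indices from 16 on count as bad, so that the cost bound
    holds for every word; the integrals below only involve indices under 16. *)
Definition penA (u : G) (t : G + nat) : R :=
  match t with inl _ => 1 | inr i => penalty (badA u i \/ (16 <= i)%nat) end.
Definition penB (t : G + nat) (v : G) : R :=
  match t with inl _ => 1 | inr i => penalty (badB v i \/ (16 <= i)%nat) end.

(** Both costs add up the letter lengths, each weighted by the penalties of the letters before it. A
    penalty in [costA] depends on the prefix already read, one in [costB] on the suffix still to
    come. *)
Fixpoint costA (u : G) (l : list (G + nat)) : R :=
  match l with
  | nil => 0
  | t :: l => len (val t) + penA u t * costA (mul u (val t)) l
  end.
Fixpoint costB (l : list (G + nat)) : R :=
  match l with nil => 0 | t :: l => len (val t) + penB t (wval l) * costB l end.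

Lemma penA_gt0 u t : 0 < penA u t.
Proof.
  destruct t; simpl; [lra|].
  match goal with |- _ < penalty ?P => generalize (penalty_bounds P) end. lra.
Qed.

Lemma penB_gt0 t v : 0 < penB t v.
Proof.
  destruct t; simpl; [lra|].
  match goal with |- _ < penalty ?P => generalize (penalty_bounds P) end. lra.
Qed.

Lemma costA_ge0 u l : 0 <= costA u l.
Proof.
  revert u; induction l as [|t l IH]; intros u; simpl; [lra|].
  generalize (len_ge0 (val t)), (penA_gt0 u t), (IH (mul u (val t))). nra.
Qed.

Lemma costB_ge0 l : 0 <= costB l.
Proof.
  induction l as [|t l IH]; simpl; [lra|].
  generalize (len_ge0 (val t)), (penB_gt0 t (wval l)). nra.
Qed.

(* As long as every Schottky letter read so far is bad on at least one side, the product of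
   the two accumulated penalties [a] and [b] stays at least 1, so [a + b >= 1] pays for the
   next letter; a letter good on both sides bounds the defect by [C] at once. *)
Lemma defect_le_cost l : forall u a b, 0 < a -> 0 < b -> 1 <= a * b ->
  defect u (wval l) <= C + 2 * (a * costA u l + b * costB l).
Proof.
  induction l as [|t l IH]; intros u a b Ha Hb Hab.
  - unfold wval; simpl. generalize (proj2 (defect_bounds u e)). rewrite len_e. lra.
  - assert (Step : 1 <= penA u t * penB t (wval l) ->
      defect u (wval (t :: l)) <= C + 2 * (a * costA u (t :: l) + b * costB (t :: l))).
    { intros Hp. assert (Ht := len_ge0 (val t)).
      (* Moving the first letter from the right factor to the left one costs at most twice its
         length. *)
      assert (H1 : defect u (wval (t :: l)) <=
        2 * len (val t) + defect (mul u (val t)) (wval l)).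
      { unfold defect. change (wval (t :: l)) with (mul (val t) (wval l)).
        rewrite <- mulA. generalize (len_mul (val t) (wval l)), (len_mul_ge u (val t)). lra. }
      assert (PA := penA_gt0 u t). assert (PB := penB_gt0 t (wval l)).
      assert (H2 := IH (mul u (val t)) (a * penA u t) (b * penB t (wval l))).
      assert (H3 : defect (mul u (val t)) (wval l) <= C + 2 *
        (a * penA u t * costA (mul u (val t)) l + b * penB t (wval l) * costB l)).
      { apply H2; try (apply Rmult_lt_0_compat; assumption).
        replace (a * penA u t * (b * penB t (wval l)))
          with ((a * b) * (penA u t * penB t (wval l))) by ring. nra. }
      assert (H4 : 1 <= a + b) by nra.
      simpl costA; simpl costB. nra. }
    destruct t as [g|i]; [apply Step; simpl; lra|].
    destruct (classic (badA u i \/ (16 <= i)%nat)) as [HA|HA];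
    [|destruct (classic (badB (wval l) i \/ (16 <= i)%nat)) as [HB|HB]].
    + apply Step. simpl. unfold penalty at 1.
      destruct (excluded_middle_informative _); [|contradiction].
      generalize (penalty_bounds (badB (wval l) i \/ (16 <= i)%nat)). lra.
    + apply Step. simpl. unfold penalty at 2.
      destruct (excluded_middle_informative (badB _ _ \/ _)); [|contradiction].
      generalize (penalty_bounds (badA u i \/ (16 <= i)%nat)). lra.
    + assert (H := good_defect u (wval l) i). change (wval (inr i :: l)) with (mul (s i) (wval l)).
      assert (Hi : (i < 16)%nat) by (apply Nat.nle_gt; tauto).
      assert (HA' : ~ badA u i) by tauto. assert (HB' : ~ badB (wval l) i) by tauto.
      specialize (H Hi HA' HB').
      generalize (costA_ge0 u (inr i :: l)), (costB_ge0 (inr i :: l)). nra.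
Qed.

(* [FI A n] integrates over words of length [n] whose unmarked letters are taken from the
   finite list [A]; being a finite sum, it needs no summability side conditions. *)
Definition FT (A : list G) (H : G + nat -> R) : R :=
  fs (fun a => unmarked a * H (inl a)) A + beta * fs (fun i => H (inr i)) (seq 0 16).

Fixpoint FI (A : list G) (n : nat) (H : list (G + nat) -> R) : R :=
  match n with
  | O => H nil
  | S n => FT A (fun t => FI A n (fun l => H (t :: l)))
  end.

Lemma FT_le A H H' : (forall t, H t <= H' t) -> FT A H <= FT A H'.
Proof.
  intros Hle. apply Rplus_le_compat.
  - apply fs_le. intros a. apply Rmult_le_compat_l; [apply unmarked_ge0|apply Hle].
  - apply Rmult_le_compat_l; [lra|]. apply fs_le. intros i; apply Hle.
Qed.

Lemma FT_plus A H H' : FT A (fun t => H t + H' t) = FT A H + FT A H'.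
Proof.
  unfold FT. rewrite fs_plus.
  replace (fun a => unmarked a * (H (inl a) + H' (inl a)))
    with (fun a => unmarked a * H (inl a) + unmarked a * H' (inl a))
    by (apply functional_extensionality; intros; ring).
  rewrite fs_plus. ring.
Qed.

Lemma FT_scal A c H : FT A (fun t => c * H t) = c * FT A H.
Proof.
  unfold FT. rewrite fs_scal.
  replace (fun a => unmarked a * (c * H (inl a)))
    with (fun a => c * (unmarked a * H (inl a)))
    by (apply functional_extensionality; intros; ring).
  rewrite fs_scal. ring.
Qed.

Lemma FT_fs {B : Type} A (H : G + nat -> B -> R) l :
  FT A (fun t => fs (H t) l) = fs (fun b => FT A (fun t => H t b)) l.
Proof.
  induction l as [|b l IH].
  - change (FT A (fun _ => 0) = 0).
    replace (fun _ : G + nat => 0) with (fun _ : G + nat => 0 * 0)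
      by (apply functional_extensionality; intros; ring).
    rewrite (FT_scal A 0 (fun _ => 0)). ring.
  - rewrite fs_cons, <- IH, <- FT_plus. reflexivity.
Qed.

Lemma FT_swap A (H : G + nat -> G + nat -> R) :
  FT A (fun t => FT A (H t)) = FT A (fun t' => FT A (fun t => H t t')).
Proof.
  unfold FT at 2. rewrite FT_plus, FT_scal, !FT_fs.
  unfold FT at 3. do 2 f_equal. apply functional_extensionality; intros a.
  apply FT_scal.
Qed.

Lemma FI_le A n : forall H H', (forall l, H l <= H' l) -> FI A n H <= FI A n H'.
Proof.
  induction n as [|n IH]; intros H H' Hle; simpl; [apply Hle|].
  apply FT_le. intros t. apply IH. intros l; apply Hle.
Qed.

Lemma FI_plus A n : forall H H', FI A n (fun l => H l + H' l) = FI A n H + FI A n H'.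
Proof.
  induction n as [|n IH]; intros H H'; simpl; [reflexivity|].
  rewrite <- FT_plus. f_equal. apply functional_extensionality; intros t. apply IH.
Qed.

Lemma FI_scal A n c : forall H, FI A n (fun l => c * H l) = c * FI A n H.
Proof.
  induction n as [|n IH]; intros H; simpl; [reflexivity|].
  rewrite <- FT_scal. f_equal. apply functional_extensionality; intros t. apply IH.
Qed.

(** Allows the first letter to be averaged with the rest of the word fixed, as the penalty in
    [costB] requires. *)
Lemma FI_swap A n : forall H : G + nat -> list (G + nat) -> R,
  FT A (fun t => FI A n (H t)) = FI A n (fun l => FT A (fun t => H t l)).
Proof.
  induction n as [|n IH]; intros H; simpl; [reflexivity|].
  rewrite FT_swap. f_equal. apply functional_extensionality; intros t'.
  apply (IH (fun t l => H t (t' :: l))).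
Qed.

Lemma unmarked_mass : Ex unmarked (fun _ => 1) = 1 - 16 * beta.
Proof.
  assert (H := Ex_split (fun _ => 1) (lin_growth_const 1 ltac:(lra))).
  rewrite Ex_const in H by (exact Hk || lra). unfold fs in H. simpl in H. lra.
Qed.

Lemma FT_1 A : NoDup A -> FT A (fun _ => 1) <= 1.
Proof.
  intros HA. unfold FT.
  assert (H := Sm_ub _ A (unmarked_sm _ (lin_growth_const 1 ltac:(lra))) HA).
  change (Sm _) with (Ex unmarked (fun _ => 1)) in H. rewrite unmarked_mass in H.
  unfold fs at 2. simpl. lra.
Qed.

Lemma FI_const A n c : NoDup A -> 0 <= c -> FI A n (fun _ => c) <= c.
Proof.
  intros HA Hc. induction n as [|n IH]; simpl; [lra|].
  apply Rle_trans with (FT A (fun _ => c * 1)).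
  - apply FT_le. intros _. lra.
  - rewrite FT_scal. generalize (FT_1 A HA). nra.
Qed.

Lemma FT_len A : NoDup A -> FT A (fun t => len (val t)) <= Ex kappa len.
Proof.
  intros HA. rewrite Ex_split by apply lin_growth_len.
  apply Rplus_le_compat_r. apply (Sm_ub (fun a => unmarked a * len a)); [|exact HA].
  apply unmarked_sm, lin_growth_len.
Qed.

(** Unmarked letters have total mass at most [1 - 16 * beta] and penalty 1. The Schottky letters
    weigh [beta] each, and their 16 penalties add up to at most 8 by [fs_penalty]. *)
Lemma FT_penalty A (P : nat -> Prop) (H : G + nat -> R) : NoDup A ->
  (forall i j, (i < 16)%nat -> (j < 16)%nat -> P i -> P j -> i = j) ->
  (forall a, H (inl a) = 1) ->
  (forall i, H (inr i) = penalty (P i \/ (16 <= i)%nat)) ->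
  FT A H <= 1 - 8 * beta.
Proof.
  intros HA HP H1 H2. unfold FT.
  assert (E := Sm_ub _ A (unmarked_sm _ (lin_growth_const 1 ltac:(lra))) HA).
  change (Sm _) with (Ex unmarked (fun _ => 1)) in E. rewrite unmarked_mass in E.
  replace (fun a => unmarked a * H (inl a)) with (fun a => unmarked a * 1)
    by (apply functional_extensionality; intros a; rewrite H1; reflexivity).
  replace (fun i => H (inr i)) with (fun i => penalty (P i \/ (16 <= i)%nat))
    by (apply functional_extensionality; intros i; rewrite H2; reflexivity).
  assert (E' := fs_penalty (fun i => P i \/ (16 <= i)%nat) (seq 0 16) (seq_NoDup 16 0)).
  rewrite length_seq in E'. simpl INR in E'.
  assert (E'' : fs (fun i => penalty (P i \/ (16 <= i)%nat)) (seq 0 16) <= 8).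
  { eapply Rle_trans; [apply E'|lra]. intros i j Hi Hj [Pi|Pi] [Pj|Pj];
    apply in_seq in Hi, Hj; try lia. apply HP; auto; lia. }
  nra.
Qed.

(* The fixed point of the recursion [b = Ex kappa len + (1 - 8 beta) b] satisfied by the
   expected costs. *)
Definition cost_bound : R := Ex kappa len / (8 * beta).

Lemma cost_bound_ge0 : 0 <= cost_bound.
Proof.
  apply Rdiv_le_0_compat; [|lra]. apply Ex_nonneg; [exact Hk|apply lin_growth_len].
Qed.

Lemma cost_bound_eq : Ex kappa len + cost_bound * (1 - 8 * beta) = cost_bound.
Proof. unfold cost_bound. field. lra. Qed.

(** By induction the cost of the remaining letters is bounded uniformly in the new prefix; averaging
    the penalty of the first letter contracts this bound by [1 - 8 * beta], and [cost_bound] is the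
    fixed point. *)
Lemma FI_costA A n : NoDup A -> forall u, FI A n (costA u) <= cost_bound.
Proof.
  intros HA. induction n as [|n IH]; intros u; simpl; [apply cost_bound_ge0|].
  apply Rle_trans with (FT A (fun t => len (val t) + cost_bound * penA u t)).
  - apply FT_le. intros t. rewrite FI_plus, FI_scal.
    assert (H1 := FI_const A n _ HA (len_ge0 (val t))).
    generalize (IH (mul u (val t))), (penA_gt0 u t). nra.
  - rewrite FT_plus, FT_scal.
    assert (H1 := FT_len A HA).
    assert (H2 := FT_penalty A (badA u) (penA u) HA (badA_unique u)
      (fun _ => eq_refl) (fun _ => eq_refl)).
    generalize cost_bound_ge0 cost_bound_eq. nra.
Qed.

(** Mirror image of [FI_costA]: the suffix is fixed first, and [badB_unique] is applied to its value
    while the first letter is averaged. *)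
Lemma FI_costB A n : NoDup A -> FI A n costB <= cost_bound.
Proof.
  intros HA. induction n as [|n IH]; simpl; [apply cost_bound_ge0|].
  rewrite FI_swap.
  apply Rle_trans with (FI A n (fun l => Ex kappa len + (1 - 8 * beta) * costB l)).
  - apply FI_le. intros l.
    replace (fun t => len (val t) + penB t (wval l) * costB l)
      with (fun t => len (val t) + costB l * penB t (wval l))
      by (apply functional_extensionality; intros; ring).
    rewrite FT_plus, FT_scal.
    assert (H1 := FT_len A HA).
    assert (H2 := FT_penalty A (badB (wval l)) (fun t => penB t (wval l)) HA
      (badB_unique (wval l)) (fun _ => eq_refl) (fun _ => eq_refl)).
    generalize (costB_ge0 l). nra.
  - rewrite FI_plus, FI_scal.
    assert (H1 := FI_const A n (Ex kappa len) HA (Ex_nonneg _ _ Hk lin_growth_len)).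
    assert (Hb : 0 <= 1 - 8 * beta).
    { assert (H := Hs 0%nat ltac:(lia)).
      assert (H' := Sm_ge1 kappa (s 0%nat) (proj1 (proj2 Hk))).
      rewrite (proj1 (proj2 (proj2 Hk))) in H'. lra. }
    generalize cost_bound_eq. nra.
Qed.

Lemma FI_defect A n u : NoDup A ->
  FI A n (fun l => defect u (wval l)) <= C + 4 * cost_bound.
Proof.
  intros HA.
  apply Rle_trans with (FI A n (fun l => C + 2 * (costA u l + costB l))).
  - apply FI_le. intros l. generalize (defect_le_cost l u 1 1). lra.
  - rewrite FI_plus, FI_scal, FI_plus.
    generalize (FI_const A n C HA C_ge0), (FI_costA A n HA u), (FI_costB A n HA). lra.
Qed.

(** What holds for all large enough lists holds simultaneously for finitely many parameters: the
    threshold lists are concatenated. *)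
Lemma incl_uniform {T : Type} (P : T -> list G -> Prop) :
  (forall t, exists A0, forall A, incl A0 A -> NoDup A -> P t A) ->
  forall ts : list T, exists A0, forall A, incl A0 A -> NoDup A ->
    forall t, In t ts -> P t A.
Proof.
  intros H ts. induction ts as [|t ts [A1 IH]].
  - exists nil. intros A _ _ t [].
  - destruct (H t) as [A2 H2]. exists (A1 ++ A2). intros A HA HN x [<-|Hx].
    + apply H2; [|exact HN]. intros a Ha; apply HA, in_app_iff; auto.
    + apply IH; [|exact HN|exact Hx]. intros a Ha; apply HA, in_app_iff; auto.
Qed.

(** Carries the uniform bounds on the finite sums [FI] over to the full expectation. *)
Lemma FI_approx n : forall F eps, lin_growth F -> 0 < eps ->
  exists A0, forall A, incl A0 A -> NoDup A ->
    Ex (pow kappa n) F - eps <= FI A n (fun l => F (wval l)).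
Proof.
  induction n as [|n IH]; intros F eps HF He.
  - exists nil. intros A _ _. destruct HF as [c [_ H]]. simpl. rewrite Ex_dirac by apply H.
    unfold wval; simpl. lra.
  - rewrite pow_S by assumption.
    set (Psi := fun a => Ex (pow kappa n) (fun b => F (mul a b))).
    assert (HPsi : lin_growth Psi) by (apply lin_growth_Ex; [apply pow_prob1|]; assumption).
    assert (Psi0 : forall g, 0 <= Psi g) by (destruct HPsi as [c [_ H]]; apply H).
    destruct (Sm_approx (fun g => unmarked g * Psi g) (eps / 2)) as [A1 [HA1 HE1]]; [lra|].
    destruct (incl_uniform (fun t A =>
      Psi (val t) - eps / 2 <= FI A n (fun l => F (wval (t :: l))))) with
      (ts := map inl A1 ++ map inr (seq 0 16)) as [A2 HA2].
    { intros t. apply (IH (fun g => F (mul (val t) g)));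
      [apply lin_growth_shift; exact HF|lra]. }
    exists (A1 ++ A2). intros A HA HN.
    assert (Hi : incl A1 A) by (intros a Ha; apply HA, in_app_iff; auto).
    specialize (HA2 A (fun a Ha => HA a (proj2 (in_app_iff _ _ _) (or_intror Ha))) HN).
    assert (Fn : forall t, 0 <= FI A n (fun l => F (wval (t :: l)))).
    { intros t. replace 0 with (FI A n (fun l => 0 * 0)) by (rewrite FI_scal; ring).
      apply FI_le. intros l. rewrite Rmult_0_l. destruct HF as [c [_ H]]. apply H. }
    rewrite Ex_split by exact HPsi. simpl FI. unfold FT.
    assert (H1 : fs (fun a => unmarked a * (Psi a - eps / 2)) A1 <=
      fs (fun a => unmarked a * FI A n (fun l => F (wval (inl a :: l)))) A).
    { eapply Rle_trans; [|apply fs_incl with (l := A1); try assumption].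
      - apply fs_le_in. intros a Ha. apply Rmult_le_compat_l; [apply unmarked_ge0|].
        apply (HA2 (inl a)). apply in_app_iff; left. apply in_map; exact Ha.
      - intros a. apply Rmult_le_pos; [apply unmarked_ge0|apply Fn]. }
    assert (H2 : fs (fun i => Psi (s i) - eps / 2) (seq 0 16) <=
      fs (fun i => FI A n (fun l => F (wval (inr i :: l)))) (seq 0 16)).
    { apply fs_le_in. intros i Hi'. apply (HA2 (inr i)).
      apply in_app_iff; right. apply in_map; exact Hi'. }
    assert (E1 : fs (fun a => unmarked a * (Psi a - eps / 2)) A1 =
      fs (fun a => unmarked a * Psi a) A1 - eps / 2 * fs (fun a => unmarked a * 1) A1).
    { replace (fun a => unmarked a * (Psi a - eps / 2))
        with (fun a => unmarked a * Psi a + (- (eps / 2)) * (unmarked a * 1))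
        by (apply functional_extensionality; intros; ring).
      rewrite fs_plus, fs_scal. ring. }
    assert (E2 : fs (fun i => Psi (s i) - eps / 2) (seq 0 16) =
      fs (fun i => Psi (s i)) (seq 0 16) - 16 * (eps / 2)).
    { replace (fun i => Psi (s i) - eps / 2) with (fun i => Psi (s i) + (- (eps / 2)))
        by (apply functional_extensionality; intros; ring).
      rewrite fs_plus. unfold fs at 2. simpl. lra. }
    (* Error budget: [eps / 2] from truncating to [A1], and from the inner approximations [eps / 2]
       times a total mass of at most 1, the unmarked part being at most [1 - 16 * beta]. *)
    assert (E3 := Sm_ub _ A1 (unmarked_sm _ (lin_growth_const 1 ltac:(lra))) HA1).
    change (Sm _) with (Ex unmarked (fun _ => 1)) in E3. rewrite unmarked_mass in E3.
    change (Sm (fun g => unmarked g * Psi g)) with (Ex unmarked Psi) in HE1.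
    nra.
Qed.

Lemma expected_defect n u : Ex (pow kappa n) (defect u) <= C + 4 * cost_bound.
Proof.
  apply le_epsilon. intros eps He.
  destruct (FI_approx n (defect u) eps (lin_growth_defect u) He) as [A0 HA].
  destruct (NoDup_merge A0 nil) as [A [HN [Hi _]]].
  generalize (HA A Hi HN), (FI_defect A n u HN). lra.
Qed.

End Schottky.

Lemma pow_len mu n : prob1 mu -> Ex (pow mu n) len <= INR n * Ex mu len.
Proof.
  intros Hm. induction n as [|n IH].
  - simpl. rewrite Ex_dirac by apply len_ge0. rewrite len_e. lra.
  - assert (Hn := pow_prob1 mu n Hm). assert (HL := lin_growth_len).
    assert (L0 := Ex_nonneg mu len Hm HL).
    simpl conv_pow. rewrite conv_Ex by assumption. rewrite S_INR.
    apply Rle_trans with (Ex (pow mu n) (fun a => len a + Ex mu len)).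
    + apply Ex_le; [exact Hn| |].
      * apply lin_growth_plus; [exact HL|apply lin_growth_const; exact L0].
      * intros a. apply Rle_trans with (Ex mu (fun b => len a + len b)).
        -- apply Ex_le; [exact Hm| |intros b; apply len_mul].
           apply lin_growth_plus; [apply lin_growth_const, len_ge0|exact HL].
        -- rewrite Ex_plus, Ex_const by (try apply lin_growth_const; auto). lra.
    + rewrite Ex_plus, Ex_const by (try apply lin_growth_const; auto). lra.
Qed.

(** Write [n = q N + r] with [r < N]: the last [r] steps change the defect by at most twice their
    length, whose mean is at most [N] times that of one step. *)
Lemma expected_defect_pow mu N C : prob1 mu -> (0 < N)%nat ->
  (forall n u, Ex (pow (pow mu N) n) (defect u) <= C) ->
  forall n u, Ex (pow mu n) (defect u) <= C + 2 * (INR N * Ex mu len).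
Proof.
  intros Hm HN HC n u.
  assert (HL := lin_growth_len). assert (Hp := fun k => pow_prob1 mu k Hm).
  assert (HD := lin_growth_defect u).
  assert (L0 : forall k, 0 <= Ex (pow mu k) len) by (intros; apply Ex_nonneg; auto).
  set (q := (n / N)%nat). set (r := (n mod N)%nat).
  assert (En : n = (q * N + r)%nat).
  { unfold q, r. rewrite Nat.mul_comm. apply Nat.div_mod_eq. }
  assert (Hr : (r < N)%nat) by (apply Nat.mod_upper_bound; lia).
  rewrite En, pow_add by assumption.
  apply Rle_trans with (Ex (pow mu (q * N)) (fun a => defect u a + 2 * Ex (pow mu r) len)).
  - apply Ex_le; [apply Hp| |].
    + apply lin_growth_plus; [exact HD|]. apply lin_growth_const.
      generalize (L0 r); lra.
    + intros a. apply Rle_trans with (Ex (pow mu r) (fun b => defect u a + 2 * len b)).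
      * apply Ex_le; [apply Hp| |].
        -- apply lin_growth_plus; [apply lin_growth_const, defect_bounds|].
           apply lin_growth_scal; [lra|exact HL].
        -- intros b. unfold defect. rewrite mulA.
           generalize (len_mul a b), (len_mul_ge (mul u a) b). lra.
      * rewrite Ex_plus, Ex_const, Ex_scal; try assumption; try lra; try apply Hp.
        -- apply defect_bounds.
        -- apply lin_growth_const, defect_bounds.
        -- apply lin_growth_scal; [lra|exact HL].
  - rewrite Ex_plus, Ex_const; try assumption; try apply Hp.
    + rewrite pow_mul by assumption.
      assert (H1 := HC q u). assert (H2 := pow_len mu r Hm).
      assert (H3 : INR r <= INR N) by (apply le_INR; lia).
      assert (H4 := Ex_nonneg mu len Hm HL). nra.
    + generalize (L0 r); lra.
    + apply lin_growth_const. generalize (L0 r); lra.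
Qed.

(** * Lipschitz estimate for the drift *)

(** Both measures have mass 1, so the constant [Phi a] may be subtracted from [Phi]. What remains is
    at most [len h + C] at [a h], and is integrated against the difference of the measures. *)
Lemma Ex_perturb_le mu1 mu2 C Phi a : prob1 mu1 -> prob1 mu2 -> 0 <= C ->
  sm (fun g => Rabs (mu1 g - mu2 g)) -> sm (fun g => len g * Rabs (mu1 g - mu2 g)) ->
  lin_growth Phi -> (forall h, Rabs (Phi (mul a h) - Phi a) <= len h + C) ->
  Ex mu1 (fun h => Phi (mul a h)) <= Ex mu2 (fun h => Phi (mul a h)) +
    (1 + C) * (Sm (fun g => Rabs (mu1 g - mu2 g)) +
               Sm (fun g => len g * Rabs (mu1 g - mu2 g))).
Proof.
  intros H1 H2 HC S0 S1 HF HPhi.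
  assert (HF' := lin_growth_shift Phi a HF).
  assert (P0 : forall g, 0 <= Phi g) by (destruct HF as [c [_ H]]; apply H).
  assert (m1 := proj1 H1). assert (m2 := proj1 H2).
  set (eta := fun g => Rabs (mu1 g - mu2 g)) in *.
  set (eta1 := fun g => len g * Rabs (mu1 g - mu2 g)) in *.
  assert (e0 : forall g, 0 <= eta g) by (intros; apply Rabs_pos).
  assert (e1 : forall g, 0 <= eta1 g).
  { intros; apply Rmult_le_pos; [apply len_ge0|apply Rabs_pos]. }
  set (c := fun _ : G => Phi a).
  assert (Hc : lin_growth c) by (apply lin_growth_const, P0).
  set (f1 := fun h => mu1 h * Phi (mul a h)). set (f2 := fun h => mu2 h * Phi (mul a h)).
  set (c1 := fun h => mu1 h * c h). set (c2 := fun h => mu2 h * c h).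
  assert (F1 : sm f1) by (apply (prob1_sm mu1); assumption).
  assert (F2 : sm f2) by (apply (prob1_sm mu2); assumption).
  assert (C1 : sm c1) by (apply (prob1_sm mu1); assumption).
  assert (C2 : sm c2) by (apply (prob1_sm mu2); assumption).
  assert (f10 : forall h, 0 <= f1 h) by (intros; apply Rmult_le_pos; auto).
  assert (f20 : forall h, 0 <= f2 h) by (intros; apply Rmult_le_pos; auto).
  assert (c10 : forall h, 0 <= c1 h) by (intros; apply Rmult_le_pos; unfold c; auto).
  assert (c20 : forall h, 0 <= c2 h) by (intros; apply Rmult_le_pos; unfold c; auto).
  assert (E1 : Sm c1 = Phi a) by (apply (Ex_const mu1); auto).
  assert (E2 : Sm c2 = Phi a) by (apply (Ex_const mu2); auto).
  set (w := fun h => (1 + C) * (eta h + eta1 h)).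
  assert (w0 : forall h, 0 <= w h).
  { intros h. unfold w. generalize (e0 h), (e1 h). nra. }
  assert (W : sm w) by (apply sm_scal; [lra|apply sm_plus; assumption]).
  assert (EW : Sm w = (1 + C) * (Sm eta + Sm eta1)).
  { unfold w. rewrite Sm_scal; [|lra|apply sm_plus; assumption].
    rewrite Sm_plus by assumption. reflexivity. }
  (* Arranged with nonnegative terms only, as additivity of [Sm] requires; the sums of [c1] and [c2]
     both equal [Phi a] and cancel. *)
  assert (H : Sm (fun h => f1 h + c2 h) <= Sm (fun h => (f2 h + c1 h) + w h)).
  { apply Sm_le; [|repeat apply sm_plus; assumption].
    intros h. unfold f1, f2, c1, c2, c, w, eta1.
    assert (Hd : (mu1 h - mu2 h) * (Phi (mul a h) - Phi a) <= eta h * (len h + C)).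
    { eapply Rle_trans; [apply Rle_abs|]. rewrite Rabs_mult.
      apply Rmult_le_compat_l; [apply Rabs_pos|apply HPhi]. }
    assert (0 <= C * (len h * eta h)).
    { repeat apply Rmult_le_pos; auto. }
    fold (eta h). generalize (e0 h). nra. }
  rewrite (Sm_plus f1 c2), (Sm_plus (fun h => f2 h + c1 h) w), (Sm_plus f2 c1) in H;
    try assumption.
  - unfold Ex. fold f1 f2. rewrite <- EW. lra.
  - intros h. generalize (f20 h), (c10 h). lra.
  - apply sm_plus; assumption.
Qed.

(** * Replacing the factors of a convolution power one at a time *)

Section Perturbation.
Context (mu mu' : G -> R) (C : R).
Hypothesis Hmu : prob1 mu.
Hypothesis Hmu' : prob1 mu'.
Hypothesis C_ge0 : 0 <= C.
Hypothesis HC : forall n u, Ex (pow mu n) (defect u) <= C.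
Hypothesis Hsm0 : sm (fun g => Rabs (mu' g - mu g)).
Hypothesis Hsm1 : sm (fun g => len g * Rabs (mu' g - mu g)).

Definition dist01 : R :=
  Sm (fun g => Rabs (mu' g - mu g)) + Sm (fun g => len g * Rabs (mu' g - mu g)).

Definition drift_from (m : nat) (a : G) : R := Ex (pow mu m) (fun b => len (mul a b)).

Lemma lin_growth_drift m : lin_growth (drift_from m).
Proof. apply lin_growth_Ex; [apply pow_prob1; exact Hmu|apply lin_growth_len]. Qed.

Lemma drift_from_bounds m a :
  len a + Ex (pow mu m) len - C <= drift_from m a <= len a + Ex (pow mu m) len.
Proof.
  assert (Hm := pow_prob1 mu m Hmu). assert (HL := lin_growth_len).
  assert (Ha := lin_growth_const (len a) (len_ge0 a)).
  assert (E : Ex (pow mu m) (fun b => len a + len b) = len a + Ex (pow mu m) len).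
  { rewrite Ex_plus, Ex_const; auto. }
  split.
  - assert (E' : Ex (pow mu m) (fun b => len (mul a b) + defect a b)
      = drift_from m a + Ex (pow mu m) (defect a)).
    { rewrite Ex_plus; auto; [apply lin_growth_shift; exact HL|apply lin_growth_defect]. }
    replace (fun b => len (mul a b) + defect a b) with (fun b => len a + len b) in E'
      by (apply functional_extensionality; intros b; unfold defect; ring).
    generalize (HC m a). lra.
  - rewrite <- E. apply Ex_le; [exact Hm|apply lin_growth_plus; assumption|].
    intros b; apply len_mul.
Qed.

(** Inserting [h] in the middle of a product [a b] can change its length by much more than [len h].
    Averaged over [b], the length is [len a] plus a constant depending only on [m], up to the defect
    bound [C]; hence an estimate uniform in [m]. *)
Lemma drift_from_lip m a h : Rabs (drift_from m (mul a h) - drift_from m a) <= len h + C.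
Proof.
  apply Rabs_le.
  generalize (drift_from_bounds m a), (drift_from_bounds m (mul a h)).
  generalize (len_mul a h), (len_mul_ge a h). lra.
Qed.

Lemma drift_from_S m a : drift_from (S m) a = Ex mu (fun h => drift_from m (mul a h)).
Proof.
  unfold drift_from. rewrite pow_S by (try apply lin_growth_shift, lin_growth_len; exact Hmu).
  f_equal. apply functional_extensionality; intros h.
  f_equal. apply functional_extensionality; intros b. rewrite mulA. reflexivity.
Qed.

Lemma Ex_shift_const nu F F' c : prob1 nu -> lin_growth F' -> 0 <= c ->
  (forall a, F a <= F' a + c) -> Ex nu F <= Ex nu F' + c.
Proof.
  intros Hn HF Hc H. assert (Hg := lin_growth_const c Hc).
  rewrite <- (Ex_const nu c) by assumption. rewrite <- Ex_plus by assumption.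
  apply Ex_le; [exact Hn|apply lin_growth_plus; assumption|exact H].
Qed.

(** The two products differ only in factor number [k + 1]. [conv_pow] splits off its last factor and
    [drift_from_S] its first, so both sides average over the same [mu'^k], and [Ex_perturb_le]
    applies pointwise. *)
Lemma telescope_step k m :
  Rabs (Ex (pow mu' (S k)) (drift_from m) - Ex (pow mu' k) (drift_from (S m)))
    <= (1 + C) * dist01.
Proof.
  assert (Hk := pow_prob1 mu' k Hmu'). assert (HD := lin_growth_drift m).
  simpl conv_pow. rewrite conv_Ex by assumption.
  assert (c0 : 0 <= (1 + C) * dist01).
  { unfold dist01. generalize (Sm_nonneg _ Hsm0), (Sm_nonneg _ Hsm1). nra. }
  assert (E : (fun g => Rabs (mu g - mu' g)) = fun g => Rabs (mu' g - mu g))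
    by (apply functional_extensionality; intros; apply Rabs_minus_sym).
  assert (E1 : (fun g => len g * Rabs (mu g - mu' g)) = fun g => len g * Rabs (mu' g - mu g))
    by (apply functional_extensionality; intros; rewrite Rabs_minus_sym; reflexivity).
  apply Rabs_le. split.
  - assert (Ex (pow mu' k) (drift_from (S m)) <=
      Ex (pow mu' k) (fun a => Ex mu' (fun b => drift_from m (mul a b))) + (1 + C) * dist01);
      [|lra].
    apply Ex_shift_const; auto; [apply lin_growth_Ex; assumption|].
    intros a. rewrite drift_from_S.
    assert (H := Ex_perturb_le mu mu' C (drift_from m) a). rewrite E, E1 in H.
    apply H; auto. intros h; apply drift_from_lip.
  - assert (Ex (pow mu' k) (fun a => Ex mu' (fun b => drift_from m (mul a b))) <=
      Ex (pow mu' k) (drift_from (S m)) + (1 + C) * dist01); [|lra].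
    apply Ex_shift_const; auto; [apply lin_growth_drift|].
    intros a. rewrite drift_from_S.
    apply Ex_perturb_le; auto. intros h; apply drift_from_lip.
Qed.

(** The product has [k] factors [mu'] followed by [m] factors [mu]. Each step trades one for the
    other, so the induction on [k] runs over all [m]. *)
Lemma telescope k m :
  Rabs (Ex (pow mu' k) (drift_from m) - Ex (pow mu (k + m)) len)
    <= INR k * ((1 + C) * dist01).
Proof.
  revert m; induction k as [|k IH]; intros m.
  - simpl. rewrite Ex_dirac.
    + unfold drift_from. replace (fun b => len (mul e b)) with len.
      * rewrite Rminus_diag, Rabs_R0. lra.
      * apply functional_extensionality; intros b. rewrite mule_l. reflexivity.
    + destruct (lin_growth_drift m) as [c [_ H]]. apply H.
  - assert (H1 := telescope_step k m). assert (H2 := IH (S m)).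
    replace (k + S m)%nat with (S k + m)%nat in H2 by lia.
    rewrite S_INR.
    assert (H3 := Rabs_triang
      (Ex (pow mu' (S k)) (drift_from m) - Ex (pow mu' k) (drift_from (S m)))
      (Ex (pow mu' k) (drift_from (S m)) - Ex (pow mu (S k + m)) len)).
    match type of H3 with Rabs ?x <= _ => replace x with
      (Ex (pow mu' (S k)) (drift_from m) - Ex (pow mu (S k + m)) len) in H3 by ring end.
    lra.
Qed.

Lemma drift_lipschitz n :
  Rabs (Ex (pow mu' n) len - Ex (pow mu n) len) <= INR n * ((1 + C) * dist01).
Proof.
  assert (H := telescope n 0). rewrite Nat.add_0_r in H.
  replace (drift_from 0) with len in H; [exact H|].
  apply functional_extensionality; intros a. unfold drift_from. simpl.
  rewrite Ex_dirac by apply len_ge0. rewrite mule_r. reflexivity.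
Qed.

End Perturbation.

End LengthFunction.

(** * Contracting orbits *)

Lemma Z_argmin (f : Z -> R) (N : nat) :
  (forall i, (Z.of_nat N < Z.abs i)%Z -> f 0%Z <= f i) -> exists m, forall i, f m <= f i.
Proof.
  assert (Hmin : forall x y, exists z, f z <= f x /\ f z <= f y).
  { intros x y. destruct (Rle_dec (f x) (f y)); [exists x|exists y]; lra. }
  assert (H : forall n : nat, exists m, forall i, (Z.abs i <= Z.of_nat n)%Z -> f m <= f i).
  { induction n as [|n [m IH]].
    - exists 0%Z. intros i Hi. replace i with 0%Z by lia. lra.
    - set (a := Z.of_nat (S n)).
      assert (Hc : forall i, (Z.abs i <= Z.of_nat (S n))%Z ->
        (Z.abs i <= Z.of_nat n)%Z \/ i = a \/ i = (- a)%Z) by (unfold a; lia).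
      destruct (Hmin m a) as [m1 [H1 H2]]. destruct (Hmin m1 (- a)%Z) as [m2 [H3 H4]].
      exists m2. intros i Hi. destruct (Hc i Hi) as [Hi'|[->| ->]]; [|lra|lra].
      generalize (IH i Hi'). lra. }
  intros Hf. destruct (H N) as [m Hm]. exists m. intros i.
  destruct (Z_le_gt_dec (Z.abs i) (Z.of_nat N)) as [Hi|Hi]; [auto|].
  apply Rle_trans with (f 0%Z); [apply Hm; lia|apply Hf; lia].
Qed.

Section Geometry.
Context {X G : Type} (d : X -> X -> R) (o : X)
  (mul : G -> G -> G) (e : G) (inv : G -> G) (act : G -> X -> X).
Hypothesis Hgeo : is_geodesic_space d.
Hypothesis Hgrp : is_group mul e inv.
Hypothesis Hact : is_isometric_action mul e d act.

Lemma d_ge0 x y : 0 <= d x y.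
Proof. apply Hgeo. Qed.
Lemma d_sym x y : d x y = d y x.
Proof. apply Hgeo. Qed.
Lemma d_tri x y z : d x z <= d x y + d y z.
Proof. apply Hgeo. Qed.
Lemma d_refl x : d x x = 0.
Proof. apply Hgeo. reflexivity. Qed.
Lemma act_e x : act e x = x.
Proof. apply Hact. Qed.
Lemma act_mul g h x : act (mul g h) x = act g (act h x).
Proof. apply Hact. Qed.
Lemma act_d g x y : d (act g x) (act g y) = d x y.
Proof. apply Hact. Qed.
Lemma act_inv_r g x : act g (act (inv g) x) = x.
Proof.
  rewrite <- act_mul. replace (mul g (inv g)) with e; [apply act_e|]. symmetry; apply Hgrp.
Qed.

Notation len := (gnorm d act o).

Lemma gnorm_ge0 g : 0 <= len g.
Proof. apply d_ge0. Qed.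

Lemma gnorm_mul g h : len (mul g h) <= len g + len h.
Proof.
  unfold gnorm. rewrite act_mul. eapply Rle_trans; [apply (d_tri _ (act g o))|].
  rewrite act_d. apply Rle_refl.
Qed.

Lemma gnorm_inv g : len (inv g) = len g.
Proof. unfold gnorm. rewrite <- (act_d g), act_inv_r. apply d_sym. Qed.

Lemma gnorm_e : len e = 0.
Proof. unfold gnorm. rewrite act_e. apply d_refl. Qed.

Lemma projP (A : X -> Prop) x y :
  proj d A x y <-> A y /\ forall a, A a -> d x y <= d x a.
Proof.
  unfold proj, dist_set.
  match goal with |- context [Glb_Rbar ?E] => destruct (Glb_Rbar_correct E) as [H1 H2] end.
  split; intros [Hy H]; (split; [exact Hy|]).
  - intros a Ha. rewrite <- H in H1. exact (H1 (d x a) (ex_intro _ a (conj Ha eq_refl))).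
  - apply Rbar_le_antisym.
    + apply H2. intros r [a [Ha ->]]. apply H; exact Ha.
    + exact (H1 (d x y) (ex_intro _ y (conj Hy eq_refl))).
Qed.

Lemma dist_set_ge (A : X -> Prop) x K :
  (forall a, A a -> K <= d x a) -> Rbar_le (Finite K) (dist_set d A x).
Proof.
  intros H. apply Glb_Rbar_correct. intros r [a [Ha ->]]. apply H; exact Ha.
Qed.

Lemma diam_ub (S : X -> Prop) x y : S x -> S y -> Rbar_le (d x y) (diam d S).
Proof.
  intros Hx Hy. unfold diam.
  match goal with |- context [Lub_Rbar ?E] => destruct (Lub_Rbar_correct E) as [H1 _] end.
  apply H1. exists x, y; auto.
Qed.

Lemma diam_lt (S : X -> Prop) x y K :
  Rbar_lt (diam d S) (Finite K) -> S x -> S y -> d x y < K.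
Proof.
  intros H Hx Hy. exact (Rbar_le_lt_trans (Finite _) _ (Finite _) (diam_ub S x y Hx Hy) H).
Qed.

(* Follow a geodesic from [z] to [z'] in unit steps up to the first one meeting the
   [K]-neighbourhood of [A]: the part before it has projection of diameter less than [K],
   hence ends close to [a]. *)
Lemma contracting_detour (A : X -> Prop) K z z' a a' :
  0 < K -> (forall x, exists y, proj d A x y) -> contracting_set d K A ->
  proj d A z a -> proj d A z' a' -> K <= d a a' ->
  d z a + d a z' <= d z z' + (4 * K + 2).
Proof.
  intros HK Hex Hcon Ha Ha' Hfar.
  destruct (proj2 Hgeo z z') as [eta [[HL Hd] [E0 EL]]]. set (L := d z z') in *.
  assert (Hclose : exists t, 0 <= t <= L /\ d (eta t) a <= 2 * K + 1).
  { set (far := fun t => forall b, A b -> K <= d (eta t) b).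
    set (P := fun k : nat => forall t, 0 <= t <= L -> t <= INR k -> far t).
    assert (Hn : exists k, ~ P k).
    (* Otherwise the whole geodesic would avoid the [K]-neighbourhood of [A], and contraction would
       give [d a a' < K]. *)
    { destruct (INR_unbounded L) as [k Hk]. exists k. intros HP.
      assert (H := Hcon eta L (conj HL Hd)
        (fun t Ht => dist_set_ge A _ K (HP t Ht ltac:(lra)))).
      assert (d a a' < K); [|lra].
      apply (diam_lt _ _ _ _ H).
      - exists z. split; [|exact Ha]. exists 0. split; [lra|auto].
      - exists z'. split; [|exact Ha']. exists L. split; [lra|auto]. }
    assert (Hk : ~ P 0%nat \/ exists k, P k /\ ~ P (S k)).
    { apply NNPP; intros Hc. destruct Hn as [k Hk]. apply Hk. clear Hk.
      induction k as [|k IH]; apply NNPP; intros Hk; apply Hc; [auto|].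
      right. exists k; auto. }
    assert (Hnot : forall k, ~ P k -> exists t b,
      0 <= t <= L /\ t <= INR k /\ A b /\ d (eta t) b < K).
    { intros k Hnk. apply NNPP; intros Hc. apply Hnk. intros t Ht Htk b Hb.
      apply Rnot_lt_le; intros Hlt. apply Hc. exists t, b; auto. }
    destruct Hk as [Hk|[k [Hk HSk]]].
    - destruct (Hnot _ Hk) as [t [b [Ht [Htk [Hb Hlt]]]]]. simpl in Htk.
      exists t. split; [exact Ht|].
      replace t with 0 in * by lra. rewrite E0 in *.
      apply projP in Ha. generalize (proj2 Ha b Hb). lra.
    - destruct (Hnot _ HSk) as [t [b [Ht [Htk [Hb Hlt]]]]]. rewrite S_INR in Htk.
      assert (Hkt : INR k < t).
      { apply Rnot_le_lt; intros Hle. generalize (Hk t Ht Hle b Hb). lra. }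
      assert (Hk0 := pos_INR k).
      exists (INR k). split; [lra|].
      (* Here [k < t <= k + 1], so the closest point [c] satisfies
         [d (eta k) c <= d (eta k) b < K + 1], and [c] is within [K] of [a]. *)
      destruct (Hex (eta (INR k))) as [c Hc].
      assert (Hac : d a c < K).
      { assert (H : is_geodesic_segment d eta (INR k)).
        { split; [exact Hk0|]. intros s1 s2 H1 H2; apply Hd; lra. }
        assert (H' := Hcon eta (INR k) H
          (fun t Ht => dist_set_ge A _ K (Hk t ltac:(lra) ltac:(lra)))).
        apply (diam_lt _ _ _ _ H').
        - exists z. split; [|exact Ha]. exists 0. split; [lra|auto].
        - exists (eta (INR k)). split; [|exact Hc]. exists (INR k). split; [lra|auto]. }
      apply projP in Hc. assert (H1 := proj2 Hc b Hb).
      assert (H2 := d_tri (eta (INR k)) (eta t) b).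
      rewrite Hd in H2 by lra. rewrite Rabs_left in H2 by lra.
      assert (H3 := d_tri (eta (INR k)) c a). rewrite (d_sym c a) in H3. lra. }
  destruct Hclose as [t [Ht Hta]].
  (* Since [eta t] lies on the geodesic, passing through [a] costs at most [2 * (2 * K + 1)]
     more. *)
  assert (H1 : d z (eta t) = t).
  { rewrite <- E0, Hd by lra. rewrite Rabs_left1; lra. }
  assert (H2 : d (eta t) z' = L - t).
  { rewrite <- EL, Hd by lra. rewrite Rabs_left1; lra. }
  assert (H3 := d_tri z (eta t) a). assert (H4 := d_tri a (eta t) z').
  rewrite (d_sym a (eta t)) in H4. lra.
Qed.

(** * Integer powers and the orbit of an element *)

Notation gp := (gpow mul e inv).
Notation orb := (orbit mul e inv act o).

Lemma mul_cancel g a b : mul g a = mul g b -> a = b.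
Proof.
  intros E. rewrite <- (mulKV mul e inv Hgrp g a), E. apply (mulKV mul e inv Hgrp).
Qed.

Lemma gpow_nat_S_r g n : gpow_nat mul e g (S n) = mul (gpow_nat mul e g n) g.
Proof.
  destruct Hgrp as [H1 [H2 [H3 _]]].
  induction n as [|n IH]; [simpl; rewrite H2, H3; reflexivity|].
  change (gpow_nat mul e g (S (S n))) with (mul g (gpow_nat mul e g (S n))).
  rewrite IH at 1. simpl. rewrite H1. reflexivity.
Qed.

Lemma gpow_of_nat g n : gp g (Z.of_nat n) = gpow_nat mul e g n.
Proof.
  destruct n; [reflexivity|]. unfold gpow, Z.of_nat.
  rewrite SuccNat2Pos.id_succ. reflexivity.
Qed.

Lemma gpow_opp_nat g n : mul (gpow_nat mul e g n) (gp g (- Z.of_nat n)) = e.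
Proof.
  destruct n; [simpl; apply Hgrp|]. unfold gpow, Z.of_nat, Z.opp.
  rewrite SuccNat2Pos.id_succ. apply Hgrp.
Qed.

Lemma gpow_succ g z : gp g (Z.succ z) = mul g (gp g z).
Proof.
  destruct (Z_le_gt_dec 0 z) as [Hz|Hz].
  - rewrite <- (Z2Nat.id z Hz), <- Nat2Z.inj_succ, !gpow_of_nat. reflexivity.
  - set (n := Z.to_nat (- z - 1)).
    replace z with (- Z.of_nat (S n))%Z by lia.
    replace (Z.succ (- Z.of_nat (S n))) with (- Z.of_nat n)%Z by lia.
    apply (mul_cancel (gpow_nat mul e g n)).
    rewrite gpow_opp_nat, (mulA mul e inv Hgrp), <- gpow_nat_S_r, gpow_opp_nat. reflexivity.
Qed.

Lemma gpow_add g a b : gp g (a + b) = mul (gp g a) (gp g b).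
Proof.
  induction a as [|a IH|a IH] using Z.peano_ind.
  - simpl. symmetry; apply Hgrp.
  - rewrite Z.add_succ_l, !gpow_succ, IH. apply (mulA mul e inv Hgrp).
  - apply (mul_cancel g). rewrite (mulA mul e inv Hgrp), <- !gpow_succ.
    rewrite Z.add_pred_l, !Z.succ_pred. exact IH.
Qed.

Lemma act_gpow_add g a b x : act (gp g (a + b)) x = act (gp g a) (act (gp g b) x).
Proof. rewrite gpow_add. apply act_mul. Qed.

Lemma act_gpow_0 g x : act (gp g 0) x = x.
Proof. apply act_e. Qed.

Lemma orb_o g : orb g o.
Proof. exists 0%Z. symmetry; apply act_e. Qed.

Lemma orb_act g k x : orb g x -> orb g (act (gp g k) x).
Proof. intros [i ->]. exists (k + i)%Z. symmetry; apply act_gpow_add. Qed.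

Lemma act_gpow_adj g k x y : d (act (gp g k) x) y = d x (act (gp g (- k)) y).
Proof.
  rewrite <- (act_d (gp g (- k)) (act (gp g k) x) y), <- act_gpow_add.
  rewrite Z.add_opp_diag_l, act_gpow_0. reflexivity.
Qed.

Lemma proj_act g k x a :
  proj d (orb g) x a -> proj d (orb g) (act (gp g k) x) (act (gp g k) a).
Proof.
  rewrite !projP. intros [Ha H]. split; [apply orb_act; exact Ha|].
  intros b Hb. rewrite act_d, act_gpow_adj. apply H, orb_act, Hb.
Qed.

Lemma quasigeodesic_lower K g k : 0 < K -> orbit_quasigeodesic mul e inv d act o K g ->
  Rabs (IZR k) <= K * (d o (act (gp g k) o) + K).
Proof.
  intros HK Hq. destruct (Hq k 0%Z) as [H _]. rewrite act_gpow_0, Z.sub_0_r, d_sym in H.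
  apply Rmult_le_reg_l with (/ K); [apply Rinv_0_lt_compat; exact HK|].
  rewrite <- (Rmult_assoc (/ K) K), Rinv_l, Rmult_1_l by lra. lra.
Qed.

Lemma quasigeodesic_upper K g k : orbit_quasigeodesic mul e inv d act o K g ->
  d o (act (gp g k) o) <= K * Rabs (IZR k) + K.
Proof.
  intros Hq. destruct (Hq k 0%Z) as [_ H]. rewrite act_gpow_0, Z.sub_0_r, d_sym in H. exact H.
Qed.

(** By the lower quasigeodesic bound, powers beyond [N] move [o] by more than [2 * d x o]. Their
    orbit points are farther from [x] than [o] is, so only finitely many compete. *)
Lemma orbit_proj_exists K g x : 0 < K -> orbit_quasigeodesic mul e inv d act o K g ->
  exists a, proj d (orb g) x a.
Proof.
  intros HK Hq.
  destruct (INR_unbounded (K * (2 * d x o + K))) as [N HN].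
  destruct (Z_argmin (fun i => d x (act (gp g i) o)) N) as [m Hm].
  - intros i Hi. rewrite act_gpow_0.
    assert (H := quasigeodesic_lower K g i HK Hq).
    rewrite <- abs_IZR in H. apply IZR_lt in Hi. rewrite <- INR_IZR_INZ in Hi.
    assert (H' : 2 * d x o + K < d o (act (gp g i) o) + K).
    { apply Rmult_lt_reg_l with K; lra. }
    assert (H1 := d_tri o x (act (gp g i) o)). rewrite (d_sym o x) in H1. lra.
  - exists (act (gp g m) o). apply projP. split; [exists m; reflexivity|].
    intros a [i ->]. apply Hm.
Qed.

(** * Schottky words from two elements with bounded projection *)

Section ContractingPair.
Context (g h : G) (K Kg B : R).
Hypothesis K_gt0 : 0 < K.
Hypothesis Kg_gt0 : 0 < Kg.
Hypothesis Hqg : orbit_quasigeodesic mul e inv d act o Kg g.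
Hypothesis Hqh : orbit_quasigeodesic mul e inv d act o K h.
Hypothesis Hch : contracting_set d K (orb h).
Hypothesis HB : forall y, proj_set d (orb h) (orb g) y -> d y o <= B.

(** A negation, so that its failure hands over a projection close to [o]. Projections of the orbit
    of [g] lie within [B] of [o]; beyond [K + B] a projection is more than [K] away from them, and
    the detour estimate applies. *)
Definition far_from (z : X) : Prop :=
  ~ exists a, proj d (orb h) z a /\ d a o <= K + B.

(* The projections of [z] and [b] to the orbit of [h] are far apart, so a geodesic from [z] to
   [b] passes near [o]; as [b] is no farther from [z] than [o], it must be near [o]. *)
Lemma far_from_near z b : far_from z -> orb g b -> d z b <= d z o ->
  d b o <= 2 * B + 4 * K + 2.
Proof.
  intros Hz Hb Hzb.
  destruct (orbit_proj_exists K h z K_gt0 Hqh) as [a Ha].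
  destruct (orbit_proj_exists K h b K_gt0 Hqh) as [b' Hb'].
  assert (Hb'o : d b' o <= B) by (apply HB; exists b; auto).
  assert (Hao : K + B < d a o).
  { apply Rnot_le_lt; intros Hle. apply Hz. exists a; auto. }
  assert (H1 := d_tri a b' o).
  assert (H := contracting_detour (orb h) K b z b' a K_gt0
    (fun x => orbit_proj_exists K h x K_gt0 Hqh) Hch Hb' Ha).
  rewrite (d_sym b' a) in H. specialize (H ltac:(lra)).
  assert (H2 := d_tri b b' o). assert (H3 := d_tri o b' z).
  rewrite (d_sym o b') in H3. rewrite (d_sym b z), (d_sym o z) in *. lra.
Qed.

(** Let [g^m o] be closest to [x] on the orbit of [g]. If [g^k x] is far, then [far_from_near] puts
    [g^(k + m) o] near [o], which bounds [k + m]; so both exponents are close to [-m]. *)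
Lemma far_from_unique x k1 k2 :
  far_from (act (gp g k1) x) -> far_from (act (gp g k2) x) ->
  Rabs (IZR (k1 - k2)) <= 2 * (Kg * (2 * B + 4 * K + 2 + Kg)).
Proof.
  intros H1 H2. destruct (orbit_proj_exists Kg g x Kg_gt0 Hqg) as [b Hb].
  destruct (projP (orb g) x b) as [Pb _]. destruct (Pb Hb) as [[m Em] _].
  assert (H : forall k, far_from (act (gp g k) x) ->
    Rabs (IZR (k + m)) <= Kg * (2 * B + 4 * K + 2 + Kg)).
  { intros k Hk. assert (Hp := proj_act g k x b Hb). apply projP in Hp.
    assert (Hn := far_from_near _ _ Hk (proj1 Hp) (proj2 Hp o (orb_o g))).
    rewrite Em, <- act_gpow_add, d_sym in Hn.
    eapply Rle_trans; [apply (quasigeodesic_lower Kg g (k + m) Kg_gt0 Hqg)|].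
    apply Rmult_le_compat_l; lra. }
  assert (E1 := H k1 H1). assert (E2 := H k2 H2).
  replace (k1 - k2)%Z with ((k1 + m) - (k2 + m))%Z by ring.
  rewrite minus_IZR.
  assert (E3 := Rabs_triang (IZR (k1 + m)) (- IZR (k2 + m))). rewrite Rabs_Ropp in E3.
  unfold Rminus. lra.
Qed.

(** The projections [a] and [h^q a1] are within [K + B] of [o] and [h^q o], hence at least [K]
    apart; a geodesic between the two points then passes near [a], and so near [o]. *)
Lemma near_far_defect z y (q : Z) a a1 :
  proj d (orb h) z a -> d a o <= K + B ->
  proj d (orb h) y a1 -> d a1 o <= K + B ->
  K + 2 * (K + B) <= d o (act (gp h q) o) ->
  d z o + d o (act (gp h q) y) <= d z (act (gp h q) y) + 2 * (K + B) + (4 * K + 2).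
Proof.
  intros Ha Hao Ha1 Ha1o Hq.
  assert (Hp := proj_act h q y a1 Ha1).
  set (z' := act (gp h q) y) in *. set (a' := act (gp h q) a1) in *.
  assert (E : d a' (act (gp h q) o) <= K + B) by (unfold a'; rewrite act_d; exact Ha1o).
  assert (T1 := d_tri o a (act (gp h q) o)). assert (T2 := d_tri a a' (act (gp h q) o)).
  rewrite (d_sym o a) in T1.
  assert (H := contracting_detour (orb h) K z z' a a' K_gt0
    (fun x => orbit_proj_exists K h x K_gt0 Hqh) Hch Ha Hp ltac:(lra)).
  assert (T3 := d_tri z a o). assert (T4 := d_tri o a z'). rewrite (d_sym o a) in T4. lra.
Qed.

(** The exponents of [g] add up to [16 p] for every [i], so that one and the same convolution power
    charges all 16 words. *)
Definition schottky (p q i : nat) : G :=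
  mul (gp g (Z.of_nat (p * i))) (mul (gp h (Z.of_nat q)) (gp g (Z.of_nat (p * (16 - i))))).

(** In the product [u s_i v], [badA] looks back from the beginning of the block [h^q], and [badB]
    looks ahead from its end. *)
Definition badA (p : nat) (u : G) (i : nat) : Prop :=
  far_from (act (gp g (- Z.of_nat (p * i))) (act (inv u) o)).
Definition badB (p : nat) (v : G) (i : nat) : Prop :=
  far_from (act (gp g (Z.of_nat (p * (16 - i)))) (act v o)).

(** Distinct multiples of [p] are at least [p] apart. *)
Lemma INR_gap (p i j : nat) c : c < INR p ->
  Rabs (IZR (Z.of_nat (p * i) - Z.of_nat (p * j))) <= c -> i = j.
Proof.
  intros Hp H. destruct (Nat.eq_dec i j) as [|Hne]; [assumption|exfalso].
  rewrite <- abs_IZR in H.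
  assert (Hz : (Z.of_nat p <= Z.abs (Z.of_nat (p * i) - Z.of_nat (p * j)))%Z).
  { rewrite !Nat2Z.inj_mul, <- Z.mul_sub_distr_l, Z.abs_mul. nia. }
  apply IZR_le in Hz. rewrite <- INR_IZR_INZ in Hz. lra.
Qed.

Lemma badA_unique p u i j : 2 * (Kg * (2 * B + 4 * K + 2 + Kg)) < INR p ->
  badA p u i -> badA p u j -> i = j.
Proof.
  intros Hp Hi Hj. apply (INR_gap p i j _ Hp).
  assert (H := far_from_unique _ _ _ Hj Hi).
  replace (- Z.of_nat (p * j) - - Z.of_nat (p * i))%Z
    with (Z.of_nat (p * i) - Z.of_nat (p * j))%Z in H by ring. exact H.
Qed.

Lemma badB_unique p v i j : 2 * (Kg * (2 * B + 4 * K + 2 + Kg)) < INR p ->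
  (i < 16)%nat -> (j < 16)%nat -> badB p v i -> badB p v j -> i = j.
Proof.
  intros Hp Li Lj Hi Hj.
  assert (16 - i = 16 - j)%nat; [|lia].
  apply (INR_gap p _ _ _ Hp). apply (far_from_unique _ _ _ Hi Hj).
Qed.

Lemma schottky_defect p q u v i : (i < 16)%nat ->
  K + 2 * (K + B) <= d o (act (gp h (Z.of_nat q)) o) ->
  ~ badA p u i -> ~ badB p v i ->
  defect mul len u (mul (schottky p q i) v) <=
    2 * (Kg * INR (p * 16) + Kg) + 2 * (K + B) + (4 * K + 2).
Proof.
  intros Hi Hq HA HB'. apply NNPP in HA. apply NNPP in HB'.
  destruct HA as [a [Ha Hao]]. destruct HB' as [a1 [Ha1 Ha1o]].
  assert (H := near_far_defect _ _ _ _ _ Ha Hao Ha1 Ha1o Hq).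
  set (k := Z.of_nat (p * i)) in *. set (m := Z.of_nat (p * (16 - i))) in *.
  set (w := act (gp h (Z.of_nat q)) (act (gp g m) (act v o))) in *.
  assert (Ew : act (mul (schottky p q i) v) o = act (gp g k) w).
  { unfold schottky, w. rewrite !act_mul. reflexivity. }
  assert (Hk : d o (act (gp g k) o) <= Kg * INR (p * 16) + Kg).
  { eapply Rle_trans; [apply (quasigeodesic_upper Kg g k Hqg)|].
    apply Rplus_le_compat_r. apply Rmult_le_compat_l; [lra|].
    unfold k. rewrite <- INR_IZR_INZ, Rabs_right by (apply Rle_ge, pos_INR).
    apply le_INR. nia. }
  unfold defect, gnorm. rewrite (act_mul u), Ew.
  (* Moving [g^(-k)] and then [u^-1] to the other side turns [H] into a statement about [u g^k o]
     and [u g^k w]; replacing [g^k o] by [o] costs [2 * d o (g^k o)]. *)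
  rewrite act_gpow_adj, Z.opp_involutive in H.
  rewrite act_gpow_adj, Z.opp_involutive in H.
  assert (Ei : forall y, d (act (inv u) o) y = d o (act u y)).
  { intros y. rewrite <- (act_d u), act_inv_r. reflexivity. }
  rewrite !Ei in H.
  assert (T1 := d_tri o (act u (act (gp g k) o)) (act u o)). rewrite act_d in T1.
  assert (T2 := d_tri o (act (gp g k) o) (act (gp g k) w)). rewrite act_d in T2.
  rewrite (d_sym (act (gp g k) o) o) in T1. lra.
Qed.

End ContractingPair.
End Geometry.

(** * The escape rate *)

Lemma LimSup_seq_correct (u : nat -> R) : is_LimSup_seq u (LimSup_seq u).
Proof. exact (proj2_sig (ex_LimSup_seq u)). Qed.

Lemma LimSup_finite (u : nat -> R) M : (forall n, Rabs (u n) <= M) ->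
  exists l, LimSup_seq u = Finite l.
Proof.
  intros H. assert (Hs := LimSup_seq_correct u).
  destruct (LimSup_seq u) as [l| |]; [exists l; reflexivity| |]; exfalso.
  - destruct (Hs M 0%nat) as [n [_ Hn]]. generalize (H n), (Rle_abs (u n)). lra.
  - destruct (Hs (- M)) as [N HN]. specialize (HN N (le_n N)).
    generalize (H N), (Rle_abs (- u N)). rewrite Rabs_Ropp. lra.
Qed.

Lemma LimSup_close (u v : nat -> R) c lu lv :
  (forall n, (1 <= n)%nat -> u n <= v n + c) ->
  LimSup_seq u = Finite lu -> LimSup_seq v = Finite lv -> lu <= lv + c.
Proof.
  intros H Eu Ev. apply Rnot_lt_le; intros Hlt.
  assert (Hu := LimSup_seq_correct u). assert (Hv := LimSup_seq_correct v).
  rewrite Eu in Hu. rewrite Ev in Hv.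
  assert (He : 0 < (lu - lv - c) / 2) by lra.
  destruct (Hv (mkposreal _ He)) as [_ [N HN]].
  destruct (Hu (mkposreal _ He)) as [H1 _]. destruct (H1 (S N)) as [n [Hn Hn']].
  specialize (HN n ltac:(lia)). specialize (H n ltac:(lia)). simpl in *. lra.
Qed.

(** [Lim_seq] is half the sum of the upper and lower limits. Both are finite by boundedness and each
    moves by at most [c]; the lower limit is handled as minus the upper limit of the negated
    sequence. *)
Lemma Lim_seq_close (u v : nat -> R) c M :
  (forall n, Rabs (u n) <= M) -> (forall n, Rabs (v n) <= M) ->
  (forall n, (1 <= n)%nat -> Rabs (u n - v n) <= c) ->
  Rabs (real (Lim_seq u) - real (Lim_seq v)) <= c.
Proof.
  intros Hu Hv H.
  assert (H1 : forall n, (1 <= n)%nat -> u n <= v n + c).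
  { intros n Hn. generalize (H n Hn), (Rle_abs (u n - v n)). lra. }
  assert (H2 : forall n, (1 <= n)%nat -> v n <= u n + c).
  { intros n Hn. generalize (H n Hn), (Rle_abs (- (u n - v n))). rewrite Rabs_Ropp. lra. }
  assert (Hu' : forall n, Rabs (- u n) <= M) by (intros; rewrite Rabs_Ropp; apply Hu).
  assert (Hv' : forall n, Rabs (- v n) <= M) by (intros; rewrite Rabs_Ropp; apply Hv).
  destruct (LimSup_finite u M Hu) as [su Eu]. destruct (LimSup_finite v M Hv) as [sv Ev].
  destruct (LimSup_finite _ M Hu') as [iu Eu']. destruct (LimSup_finite _ M Hv') as [iv Ev'].
  assert (A1 := LimSup_close u v c su sv H1 Eu Ev).
  assert (A2 := LimSup_close v u c sv su H2 Ev Eu).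
  assert (A3 := LimSup_close (fun n => - u n) (fun n => - v n) c iu iv
    (fun n Hn => ltac:(generalize (H2 n Hn); lra)) Eu' Ev').
  assert (A4 := LimSup_close (fun n => - v n) (fun n => - u n) c iv iu
    (fun n Hn => ltac:(generalize (H1 n Hn); lra)) Ev' Eu').
  assert (E : forall w s i, LimSup_seq w = Finite s ->
    LimSup_seq (fun n => - w n) = Finite i -> real (Lim_seq w) = (s - i) / 2).
  { intros w s i Es Ei. rewrite LimSup_seq_opp in Ei. unfold Lim_seq. rewrite Es.
    destruct (LimInf_seq w) as [r| |]; simpl in *; try discriminate.
    injection Ei as <-. lra. }
  rewrite (E u su iu Eu Eu'), (E v sv iv Ev Ev'). apply Rabs_le. lra.
Qed.

Lemma finite_pos_lower (f : nat -> R) n :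
  (forall i, (i < n)%nat -> 0 < f i) -> exists m, 0 < m /\ forall i, (i < n)%nat -> m <= f i.
Proof.
  induction n as [|n IH]; intros H.
  - exists 1. split; [lra|]. intros; lia.
  - destruct IH as [m [Hm IH]]; [intros; apply H; lia|].
    exists (Rmin m (f n)). split; [apply Rmin_pos; [exact Hm|apply H; lia]|].
    intros i Hi. destruct (Nat.eq_dec i n) as [->|Hne]; [apply Rmin_r|].
    eapply Rle_trans; [apply Rmin_l|]. apply IH; lia.
Qed.

Lemma nnsum_ge0 {A : Type} (f : A -> R) : Rbar_le 0 (nnsum f).
Proof.
  unfold nnsum.
  match goal with |- context [Lub_Rbar ?E] => destruct (Lub_Rbar_correct E) as [H _] end.
  exact (H 0 (ex_intro _ nil (conj (NoDup_nil A) eq_refl))).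
Qed.

(** * Applying the abstract bounds to the displacement of the basepoint *)

Section Assembly.
Context {X G : Type} (d : X -> X -> R) (o : X)
  (mul : G -> G -> G) (e : G) (inv : G -> G) (act : G -> X -> X).
Hypothesis Hgeo : is_geodesic_space d.
Hypothesis Hgrp : is_group mul e inv.
Hypothesis Hact : is_isometric_action mul e d act.

Notation len := (gnorm d act o).
Notation pow := (conv_pow mul e inv).

(** Both norms are at least 0, so a finite total forces each to be finite and excludes the default
    values of [Rbar_plus]. *)
Lemma norm01_summable (eta : G -> R) eps :
  Rbar_lt (norm01 d act o eta) (Finite eps) ->
  sm (fun g => Rabs (eta g)) /\ sm (fun g => len g * Rabs (eta g)) /\
  real (norm01 d act o eta) = Sm (fun g => Rabs (eta g)) + Sm (fun g => len g * Rabs (eta g)).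
Proof.
  intros H. unfold norm01, norm0, norm1 in *.
  assert (H0 := nnsum_ge0 (fun g => Rabs (eta g))).
  assert (H1 := nnsum_ge0 (fun g => len g * Rabs (eta g))).
  assert (S0 : sm (fun g => Rabs (eta g))).
  { apply sm_of_nnsum. destruct (nnsum (fun g => Rabs (eta g))); simpl in *; auto.
    destruct (nnsum _); simpl in *; auto. }
  assert (S1 : sm (fun g => len g * Rabs (eta g))).
  { apply sm_of_nnsum. destruct (nnsum (fun g => len g * Rabs (eta g))); simpl in *; auto.
    destruct (nnsum _); simpl in *; auto. }
  rewrite (nnsum_sm _ S0), (nnsum_sm _ S1). auto.
Qed.

Lemma is_prob_prob1 (mu : G -> R) :
  is_prob mu -> sm (fun g => mu g * len g) -> prob1 len mu.
Proof.
  intros [H0 H1] H2.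
  assert (S : sm mu) by (apply sm_of_nnsum; rewrite H1; exact I).
  repeat split; auto. unfold Sm. rewrite H1. reflexivity.
Qed.

Lemma independent_expected_defect (mu : G -> R) :
  prob1 len mu -> non_elementary mul e inv d act o mu ->
  exists C, 0 <= C /\ forall n u, Ex (pow mu n) (defect mul len u) <= C.
Proof.
  intros Hmu [g [h [[lg [Hlg [Fg Eg]]] [[lh [_ [Fh Eh]]] [Cg [Ch [_ Hbd]]]]]]].
  assert (len0 := gnorm_ge0 d o act Hgeo).
  assert (lenM := gnorm_mul d o mul e act Hgeo Hact).
  assert (lenI := gnorm_inv d o mul e inv act Hgeo Hgrp Hact).
  assert (lenE := gnorm_e d o mul e act Hgeo Hact).
  destruct Cg as [Kg [Kg0 [Qg _]]]. destruct Ch as [K [K0 [Qh Ch]]].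
  assert (HB : exists B, 0 <= B /\ forall y,
    proj_set d (orbit mul e inv act o h) (orbit mul e inv act o g) y -> d y o <= B).
  (* The basepoint lies on both orbits and is its own projection, so a bound on the diameter bounds
     distances to [o]. *)
  { assert (Ho : proj_set d (orbit mul e inv act o h) (orbit mul e inv act o g) o).
    { exists o. split; [apply (orb_o d); assumption|]. apply (projP d).
      split; [apply (orb_o d); assumption|].
      intros a _. rewrite (d_refl d Hgeo). apply d_ge0; exact Hgeo. }
    assert (Hub := fun y Hy => diam_ub d _ y o Hy Ho).
    unfold Defs.bounded in Hbd. destruct (diam d _) as [B| |]; try contradiction.
    - exists B. split; [|exact Hub]. generalize (Hub o Ho). simpl.
      rewrite (d_refl d Hgeo). auto.
    - exfalso; exact (Hub o Ho). }
  destruct HB as [B [B0 HB]].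
  (* [p] exceeds the spread of exponents in [far_from_unique], so at most one index is bad on each
     side; [q] makes [h^q o] far enough from [o] for [near_far_defect]. *)
  destruct (INR_unbounded (2 * (Kg * (2 * B + 4 * K + 2 + Kg)))) as [p Hp].
  destruct (INR_unbounded (K * (K + 2 * (K + B) + K))) as [q Hq].
  assert (Hq' : K + 2 * (K + B) <= d o (act (gpow mul e inv h (Z.of_nat q)) o)).
  { assert (H := quasigeodesic_lower d o mul e inv act Hgeo Hact K h (Z.of_nat q) K0 Qh).
    rewrite <- INR_IZR_INZ, Rabs_right in H by (apply Rle_ge, pos_INR).
    assert (K + 2 * (K + B) + K < d o (act (gpow mul e inv h (Z.of_nat q)) o) + K); [|lra].
    apply Rmult_lt_reg_l with K; lra. }
  assert (Hp0 : (0 < p)%nat).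
  { apply INR_lt. simpl. eapply Rle_lt_trans; [|exact Hp].
    apply Rmult_le_pos; [lra|]. apply Rmult_le_pos; lra. }
  (* The word length of every [s i] in letters charged by [mu]. *)
  set (N := (p * 16 * length lg + q * length lh)%nat).
  assert (HN : (0 < N)%nat).
  { destruct lg; [congruence|]. unfold N. simpl length. nia. }
  assert (Pg := pow_pos_word mul e inv len Hgrp len0 lenM mu lg Hmu Fg). rewrite <- Eg in Pg.
  assert (Ph := pow_pos_word mul e inv len Hgrp len0 lenM mu lh Hmu Fh). rewrite <- Eh in Ph.
  set (s := schottky mul e inv g h p q).
  assert (Ps : forall i, (i < 16)%nat -> 0 < pow mu N (s i)).
  { intros i Hi. unfold s, schottky. rewrite !gpow_of_nat.
    replace N with ((p * i) * length lg + (q * length lh + (p * (16 - i)) * length lg))%nat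
      by (unfold N; nia).
    repeat apply (pow_pos_mul mul e inv len Hgrp len0 lenM); try exact Hmu;
      apply (pow_pos_gpow_nat mul e inv len Hgrp len0 lenM); assumption. }
  destruct (finite_pos_lower (fun i => pow mu N (s i)) 16 Ps) as [m [Hm Hms]].
  assert (Hk := pow_prob1 mul e inv len Hgrp len0 lenM mu N Hmu).
  set (C := 2 * (Kg * INR (p * 16) + Kg) + 2 * (K + B) + (4 * K + 2)).
  assert (C0 : 0 <= C).
  { unfold C. assert (Hi := pos_INR (p * 16)). nra. }
  (* [beta] is [m / 16], since each [s i] must have mass at least [16 * beta]. *)
  assert (HE := expected_defect mul e inv len Hgrp len0 lenM lenI lenE (pow mu N) s
    (badA d o mul e inv act g h K B p) (badB d o mul e inv act g h K B p) (m / 16) C Hk C0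
    ltac:(lra) (fun i Hi => ltac:(generalize (Hms i Hi); lra))
    (fun u i j _ _ => badA_unique d o mul e inv act Hgeo Hgrp Hact g h K Kg B
       K0 Kg0 Qg Qh Ch HB p u i j Hp)
    (fun v i j Hi Hj => badB_unique d o mul e inv act Hgeo Hgrp Hact g h K Kg B
       K0 Kg0 Qg Qh Ch HB p v i j Hp Hi Hj)
    (fun u v i Hi => schottky_defect d o mul e inv act Hgeo Hgrp Hact g h K Kg B
       K0 Kg0 Qg Qh Ch p q u v i Hi Hq')).
  assert (HF := expected_defect_pow mul e inv len Hgrp len0 lenM lenI lenE mu N _ Hmu HN HE).
  eexists. split; [|exact HF].
  (* The constant bounds the expectation of a nonnegative function, hence is nonnegative. *)
  eapply Rle_trans; [|exact (HF 0%nat e)].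
  apply (Ex_nonneg len len0).
  - apply (pow_prob1 mul e inv len Hgrp len0 lenM); exact Hmu.
  - apply (lin_growth_defect mul e inv len Hgrp len0 lenM lenI).
Qed.

Lemma drift_ratio_bound (mu : G -> R) n : prob1 len mu ->
  Rabs (Lmu d act o (pow mu n) / INR n) <= Ex mu len.
Proof.
  intros Hmu.
  assert (len0 := gnorm_ge0 d o act Hgeo).
  assert (lenM := gnorm_mul d o mul e act Hgeo Hact).
  assert (lenE := gnorm_e d o mul e act Hgeo Hact).
  assert (HL := lin_growth_len len len0).
  assert (L0 := Ex_nonneg len len0 mu len Hmu HL).
  assert (Ln0 := Ex_nonneg len len0 _ len
    (pow_prob1 mul e inv len Hgrp len0 lenM mu n Hmu) HL).
  assert (H := pow_len mul e inv len Hgrp len0 lenM lenE mu n Hmu).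
  change (Lmu d act o (pow mu n)) with (Ex (pow mu n) len).
  destruct n as [|n].
  (* At [n = 0] the quotient is 0 by the convention [/ 0 = 0]. *)
  - simpl. unfold Rdiv. rewrite Rinv_0, Rmult_0_r, Rabs_R0. exact L0.
  - assert (Hn : 0 < INR (S n)) by (apply lt_0_INR; lia).
    rewrite Rabs_right.
    + apply Rmult_le_reg_r with (INR (S n)); [exact Hn|].
      unfold Rdiv. rewrite Rmult_assoc, Rinv_l by lra. lra.
    + apply Rle_ge, Rdiv_le_0_compat; assumption.
Qed.

End Assembly.

Theorem theorem1p2
  (X : Type) (d : X -> X -> R) (o : X)
  (G : Type) (mul : G -> G -> G) (e : G) (inv : G -> G) (act : G -> X -> X)
  (mu : G -> R) :
  is_geodesic_space d ->
  is_group mul e inv ->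
  is_countable G ->
  is_isometric_action mul e d act ->
  (exists g h, independent mul e inv d act o g h) ->
  is_prob mu ->
  non_elementary mul e inv d act o mu ->
  finite_first_moment d act o mu ->
  exists C eps : R, 0 < C /\ 0 < eps /\
    forall mu' : G -> R, is_prob mu' ->
      Rbar_lt (norm01 d act o (fun g => mu' g - mu g)) (Finite eps) ->
      Rabs (escape_rate mul e inv d act o mu' - escape_rate mul e inv d act o mu)
        <= C * real (norm01 d act o (fun g => mu' g - mu g)).
Proof.
  intros Hgeo Hgrp _ Hact _ Hprob Hne Hfm.
  assert (len0 := gnorm_ge0 d o act Hgeo).
  assert (lenM := gnorm_mul d o mul e act Hgeo Hact).
  assert (lenI := gnorm_inv d o mul e inv act Hgeo Hgrp Hact).
  assert (Sl : sm (fun g => mu g * gnorm d act o g)).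
  { apply sm_le with (2 := sm_of_nnsum _ Hfm). intros g.
    rewrite Rabs_right by (apply Rle_ge, Hprob). rewrite Rmult_comm. apply Rle_refl. }
  assert (Hmu := is_prob_prob1 d o act mu Hprob Sl).
  destruct (independent_expected_defect d o mul e inv act Hgeo Hgrp Hact mu Hmu Hne)
    as [C [C0 HC]].
  (* The constant is that of [drift_lipschitz]; the radius 1 ensures that the distance of the
     measures is finite. *)
  exists (1 + C), 1. split; [lra|]. split; [lra|]. intros mu' Hprob' Hlt.
  destruct (norm01_summable d o act _ _ Hlt) as [S0 [S1 ->]].
  assert (Hmu' : prob1 (gnorm d act o) mu').
  { apply is_prob_prob1; [exact Hprob'|].
    (* The first moment of [mu'] is finite because [mu' <= mu + |mu' - mu|]. *)
    apply sm_le with (2 := sm_plus _ _ Sl S1). intros g.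
    generalize (Rle_abs (mu' g - mu g)), (len0 g). nra. }
  unfold escape_rate.
  apply Lim_seq_close with
    (Rmax (Ex mu' (gnorm d act o)) (Ex mu (gnorm d act o))).
  - intros n. eapply Rle_trans; [apply drift_ratio_bound; assumption|apply Rmax_l].
  - intros n. eapply Rle_trans; [apply drift_ratio_bound; assumption|apply Rmax_r].
  - intros n Hn. assert (Hn' : 0 < INR n) by (apply lt_0_INR; lia).
    assert (H := drift_lipschitz mul e inv (gnorm d act o) Hgrp len0 lenM lenI mu mu' C
      Hmu Hmu' C0 HC S0 S1 n). unfold dist01 in H.
    unfold Rdiv. rewrite <- Rmult_minus_distr_r, Rabs_mult.
    rewrite (Rabs_right (/ INR n)) by (apply Rle_ge, Rlt_le, Rinv_0_lt_compat; exact Hn').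
    apply Rmult_le_reg_r with (INR n); [exact Hn'|].
    rewrite Rmult_assoc, Rinv_l, Rmult_1_r by lra. rewrite (Rmult_comm _ (INR n)). exact H.
Qed.
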